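(* Let $\mathscr{S}$ be an oriented minimal surface with negative Gaussian curvature in three-dimensional Euclidean space, with unit normal $\bm{\nu}$, and let $\varphi$ be any surface harmonic function of class $C^2$ on $\mathscr{S}$. Then, locally on $\mathscr{S}$, there exists a scalar field $\alpha$, itself surface harmonic, with $$\nabla_{\mathrm s}\alpha=\bm{\nu}\times\nabla_{\mathrm s}\varphi ,$$ and there exists, locally on $\mathscr{S}$ and uniquely to within a translation once $\alpha$ is chosen, a bending-neutral deformation $\bm{y}$ of $\mathscr{S}$ such that $$\nabla_{\mathrm s}\bm{y}=\mathrm{e}^{\varphi}\,\mathbf{R}_{\bm{\nu}}(\alpha)\,\mathbf{P}(\bm{\nu}).$$ The image $\mathscr{S}^\ast=\bm{y}(\mathscr{S})$ of every such deformation is a minimal surface.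
   Context: For a smooth oriented surface $\mathscr{S}$ with unit normal $\bm{\nu}$: $\mathbf{P}(\bm{\nu})=\mathbf{I}-\bm{\nu}\otimes\bm{\nu}$ is the projection onto the tangent plane; the surface gradient $\nabla_{\mathrm s}$ of a (scalar or vector) field on $\mathscr{S}$ is (gradient of any smooth extension) composed with $\mathbf{P}(\bm{\nu})$, so it is the differential along $\mathscr{S}$ extended by zero on $\bm{\nu}$; for a scalar field it is the tangential gradient vector. The surface Laplacian $\Delta_{\mathrm s}$ is the surface divergence (the trace of the surface gradient) of $\nabla_{\mathrm s}$, i.e. the Laplace–Beltrami operator, and $\varphi$ of class $C^2$ is surface harmonic if $\Delta_{\mathrm s}\varphi=0$. $\mathbf{W}(\bm{\nu})$ is the skew tensor with $\mathbf{W}(\bm{\nu})\bm{v}=\bm{\nu}\times\bm{v}$, and $\mathbf{R}_{\bm{\nu}}(\alpha)=\mathbf{I}+\sin\alpha\,\mathbf{W}(\bm{\nu})-(1-\cos\alpha)\mathbf{P}(\bm{\nu})$ is the rotation by angle $\alpha$ about $\bm{\nu}$. A deformation $\bm{y}$ of $\mathscr{S}$ has surface gradient with polar decomposition $\nabla_{\mathrm s}\bm{y}=\mathbf{R}_{\bm{y}}\mathbf{U}_{\bm{y}}$, where $\mathbf{R}_{\bm{y}}$ is a field of rotations and $\mathbf{U}_{\bm{y}}$ is a symmetric tensor annihilating $\bm{\nu}$, mapping each tangent plane into itself and positive definite there. $\bm{y}$ is called bending-neutral if at every point of $\mathscr{S}$ the rotation $\mathbf{R}_{\bm{y}}$ is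 a rotation about $\bm{\nu}$ (i.e. $\mathbf{R}_{\bm{y}}\bm{\nu}=\bm{\nu}$). A surface is minimal if its mean curvature vanishes. *)

(* Defs.v *)
(* MathComp-Analysis: Euclidean 3-space is 'cV[R]_3 over R : realType; tensors
   are 3 x 3 matrices acting on columns.  The norm of the library on matrices
   is the sup norm, so the Euclidean structure is given by [dot]; topology and
   differentiability do not depend on this choice. *)
From HB Require Import structures.
From mathcomp Require Import all_boot all_order all_algebra.
From mathcomp Require Import all_classical all_reals all_analysis.
Set Implicit Arguments.
Unset Strict Implicit.
Unset Printing Implicit Defensive.
Import Order.TTheory GRing.Theory Num.Theory.
Import numFieldNormedType.Exports.
Local Open Scope classical_set_scope.
Local Open Scope ring_scope.

Section Tensors.
Variable R : realType.
Implicit Types (n u v : 'cV[R]_3).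

Definition dot u v : R := \sum_i u i 0 * v i 0.

(* indices are taken mod 3: 'I_3 is the ring Z/3 *)
Definition cross u v : 'cV[R]_3 :=
  \col_i (u (i + 1) 0 * v (i + 2) 0 - u (i + 2) 0 * v (i + 1) 0).

Definition tanproj n : 'M[R]_3 := 1%:M - n *m n^T.

Definition skew_tensor n : 'M[R]_3 := \matrix_(i, j) cross n (delta_mx j 0) i 0.

Definition rotmx n (a : R) : 'M[R]_3 :=
  1%:M + sin a *: skew_tensor n - (1 - cos a) *: tanproj n.

Definition is_rotation (Q : 'M[R]_3) : Prop := Q^T *m Q = 1%:M /\ \det Q = 1.

(* G = Q U is the polar decomposition of a surface gradient G at a point with
   unit normal n; the tangent plane is the orthogonal complement of n. *)
Definition polar n (G Q U : 'M[R]_3) : Prop :=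
  [/\ is_rotation Q, U^T = U /\ U *m n = 0,
      forall v, dot n v = 0 -> dot n (U *m v) = 0,
      forall v, dot n v = 0 -> v != 0 -> 0 < dot v (U *m v)
    & G = Q *m U].

End Tensors.

(* Class C^k on an open set U, for finite-dimensional V: f is differentiable
   and its directional derivatives are of class C^(k-1). *)
Fixpoint class_C (R : realType) (V W : normedModType R) (k : nat)
    (f : V -> W) (U : set V) : Prop :=
  if k is k'.+1 then
    (forall x, U x -> differentiable f x) /\
    (forall v : V, class_C k' (fun x => 'D_v f x) U)
  else forall x, U x -> {for x, continuous f}.

Section Surfaces.
Variable R : realType.
Implicit Types (S V : set 'cV[R]_3) (p q : 'cV[R]_3).

(* X is a diffeomorphism of class C^2 from the open set D of the plane onto
   the part of S in the open set V: its inverse is the restriction of a map Z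
   of class C^2 on V, which also makes X an immersion and a homeomorphism. *)
Definition chart S (D : set 'cV[R]_2) V
    (X : 'cV[R]_2 -> 'cV[R]_3) (Z : 'cV[R]_3 -> 'cV[R]_2) : Prop :=
  [/\ open D /\ open V, class_C 2 X D, class_C 2 Z V,
      forall u, D u -> Z (X u) = u
    & X @` D = S `&` V].

Definition surface S : Prop :=
  forall p, S p -> exists D V X Z, chart S D V X Z /\ V p.

Definition tangent S p (v : 'cV[R]_3) : Prop :=
  exists D V X Z u h,
    [/\ chart S D V X Z, D u, X u = p & v = 'D_h X u].

(* Fields on S are total functions whose values outside S are irrelevant;
   [extends k S f p F]: F extends f near p and is of class C^k there. *)
Definition extends (W : normedModType R) (k : nat) S (f : 'cV[R]_3 -> W) p
    (F : 'cV[R]_3 -> W) : Prop :=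
  exists V, [/\ open_nbhs p V, class_C k F V
              & forall x, S x -> V x -> F x = f x].

Definition field_C (W : normedModType R) (k : nat) S (f : 'cV[R]_3 -> W)
    : Prop :=
  forall p, S p -> exists F, extends k S f p F.

Definition oriented_surface S (nu : 'cV[R]_3 -> 'cV[R]_3) : Prop :=
  [/\ surface S, field_C 1 S nu,
      forall p, S p -> dot (nu p) (nu p) = 1
    & forall p v, S p -> tangent S p v -> dot (nu p) v = 0].

Definition grad (f : 'cV[R]_3 -> R) p : 'cV[R]_3 :=
  \col_j 'D_(delta_mx j 0) f p.

Definition vgrad (f : 'cV[R]_3 -> 'cV[R]_3) p : 'M[R]_3 :=
  \matrix_(i, j) ('D_(delta_mx j 0) f p) i 0.

(* Surface gradients of scalar and of vector fields.  The value does not depend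
   on the extension F; it is 0 by convention when there is none, i.e. when f
   is not of class C^1 near p. *)
Definition sgrad S nu (f : 'cV[R]_3 -> R) p : 'cV[R]_3 :=
  xget 0 [set g | exists F, extends 1 S f p F /\
                            g = tanproj (nu p) *m grad F p].

Definition vsgrad S nu (f : 'cV[R]_3 -> 'cV[R]_3) p : 'M[R]_3 :=
  xget 0 [set G | exists F, extends 1 S f p F /\
                            G = vgrad F p *m tanproj (nu p)].

Definition sdiv S nu (f : 'cV[R]_3 -> 'cV[R]_3) p : R := \tr (vsgrad S nu f p).

Definition slaplace S nu (f : 'cV[R]_3 -> R) p : R :=
  sdiv S nu (sgrad S nu f) p.

Definition surface_harmonic S nu (f : 'cV[R]_3 -> R) : Prop :=
  field_C 2 S f /\ forall p, S p -> slaplace S nu f p = 0.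

(* Curvatures from the curvature tensor, the surface gradient L of nu.  As L is
   symmetric and annihilates nu, adding nu (x) nu makes the determinant that of
   the restriction of L to the tangent plane. *)
Definition mean_curvature S nu p : R := sdiv S nu nu p / 2.

Definition gauss_curvature S nu p : R :=
  \det (vsgrad S nu nu p + nu p *m (nu p)^T).

Definition minimal_surface S nu : Prop :=
  oriented_surface S nu /\ forall p, S p -> mean_curvature S nu p = 0.

Definition deformation S nu (y : 'cV[R]_3 -> 'cV[R]_3) : Prop :=
  field_C 2 S y /\
  forall p, S p -> exists Q U, polar (nu p) (vsgrad S nu y p) Q U.

Definition bending_neutral S nu (y : 'cV[R]_3 -> 'cV[R]_3) : Prop :=
  deformation S nu y /\
  forall p Q U, S p -> polar (nu p) (vsgrad S nu y p) Q U ->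
    Q *m nu p = nu p.

Definition embedding S (y : 'cV[R]_3 -> 'cV[R]_3) : Prop :=
  {within S, continuous y} /\
  exists z : 'cV[R]_3 -> 'cV[R]_3,
    (forall p, S p -> z (y p) = p) /\ {within y @` S, continuous z}.

(* y(S) is a minimal surface.  A deformation is an immersion whose image may
   meet itself, so this is asserted of the image of every (relatively open)
   part of S that y embeds, and such parts cover S.  If y embeds S, then y(S)
   itself is such an image. *)
Definition minimal_image S (y : 'cV[R]_3 -> 'cV[R]_3) : Prop :=
  (forall p, S p -> exists V, open_nbhs p V /\ embedding (S `&` V) y) /\
  (forall V, open V -> embedding (S `&` V) y ->
     exists nu', minimal_surface (y @` (S `&` V)) nu').

End Surfaces.

(* Main.v *)
Require Import Defs.
From HB Require Import structures.
From mathcomp Require Import all_boot all_order all_algebra.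
From mathcomp Require Import all_classical all_reals all_analysis.
From mathcomp Require Import ring lra.
Import Order.TTheory GRing.Theory Num.Theory.
Import numFieldNormedType.Exports.
Local Open Scope classical_set_scope.
Local Open Scope ring_scope.

(** Let X be a local parametrisation of the surface, N its unit normal and g the
    surface gradient of phi along X; indices denote partial derivatives in the
    parameter plane.  A surface gradient annihilates the normal and sends X_i to
    the i-th derivative of the field read in the chart ([vsgradP], [sgradP]), so
    everything happens in the frame X_1, X_2, N.  The trace identity [tr_cross]
    turns div f = 0 into N.(f_1 x X_2 + X_1 x f_2) = 0 ([sdiv_eq0]); minimality
    (f = nu) and harmonicity (f = grad phi) are used in this form.

    The conjugate alpha must satisfy alpha_i = (N x g).X_i.  This form is closed:
    its exterior derivative reduces to the divergence of grad phi and to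
    g.(N_1 x X_2 + X_1 x N_2), which vanishes by minimality ([conjugate_closed]).
    The Poincare lemma yields alpha, and alpha is harmonic because the Hessian of
    phi and the curvature tensor are symmetric ([conjugate_harmonic]).

    The deformation must satisfy y_i = e^phi (cos alpha X_i + sin alpha N x X_i).
    This form is closed as well ([deformation_closed]): the differential of alpha
    is that of phi turned by a right angle, so the terms in which they occur cancel
    ([gradient_turn]), and the derivatives of N contribute only
    N_1 x X_2 + X_1 x N_2 = 0.  Bending neutrality is the uniqueness of the polar
    decomposition ([polar_conformal_normal]); two solutions have the same gradient,
    hence differ by a constant ([solution_unique]).

    The image has normal nu(p) at y(p), since y_1 and y_2 are orthogonal to N.
    Its mean curvature vanishes because N.(N_1 x y_2 + y_1 x N_2) is a combination
    of N.(N_1 x X_2 + X_1 x N_2) and of N_1.X_2 - N_2.X_1 ([rotated_minimal]).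
    That it has charts with C^2 left inverses follows from the inverse function
    theorem in the plane ([local_inverse]), applied to y o X followed by a linear
    left inverse of its differential ([immersion_left_inverse]).

    The calculus on which this rests is developed first: the chain rule for maps
    of class C^k, the symmetry of second derivatives ([derive_comm]), the inverse
    function theorem and the Poincare lemma ([poincare]). *)

Set Implicit Arguments.
Unset Strict Implicit.
Unset Printing Implicit Defensive.

(** * Maps of class C^k *)

Section ClassC.
Context {R : realType}.
Implicit Types V W : normedModType R.

Lemma class_CS V W k (f : V -> W) U : class_C k.+1 f U -> class_C k f U.
Proof.
elim: k f => [|k IH] f [df Df] /=.
  by move=> x Ux; exact/differentiable_continuous/df.
by split=> // v; apply: IH; exact: Df.
Qed.

Lemma class_C_le V W j k (f : V -> W) U : (j <= k)%N -> class_C k f U -> class_C j f U.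
Proof.
move=> /subnK <-; elim: (k - j)%N => [//|i IH] /class_CS; exact: IH.
Qed.

Lemma class_C_differentiable V W k (f : V -> W) U x :
  class_C k.+1 f U -> U x -> differentiable f x.
Proof. by move=> [+ _]; exact. Qed.

Lemma class_C_derive V W k (f : V -> W) U v :
  class_C k.+1 f U -> class_C k ('D_v f) U.
Proof. by move=> [_]; exact. Qed.

Lemma class_C_subset V W k (f : V -> W) A B :
  A `<=` B -> class_C k f B -> class_C k f A.
Proof.
move=> AB; elim: k f => [|k IH] f /=; first by move=> cf x /AB; exact: cf.
by move=> [df Df]; split=> [x /AB|v]; [exact: df|exact: IH].
Qed.

Lemma open_near_eq V W (f g : V -> W) U x :
  open U -> (forall x, U x -> f x = g x) -> U x -> {near x, f =1 g}.
Proof.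
move=> oU fg Ux; have := open_nbhs_nbhs (conj oU Ux).
by apply: filterS => y; exact: fg.
Qed.

Lemma near_eq_continuous V W (f g : V -> W) x :
  {near x, f =1 g} -> {for x, continuous f} -> {for x, continuous g}.
Proof.
move=> fg cf; rewrite /prop_for /continuous_at -(nbhs_singleton fg).
by apply: cvg_trans cf; apply: near_eq_cvg; apply: filterS fg => y ->.
Qed.

(** The first order expansion of f at x also expands g, and the differential is
    determined by such an expansion. *)
Lemma near_eq_differentiable V W (f g : V -> W) x :
  {near x, f =1 g} -> differentiable f x -> differentiable g x.
Proof.
move=> fg df; have fgx := nbhs_singleton fg.
have go : g \o shift x = cst (g x) + 'd f x +o_ 0 id.
  apply/eqaddoP => e e0.
  have /eqaddoP/(_ e e0) := diff_locally df.
  have : \forall y \near 0, f (y + x) = g (y + x).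
    move: fg; rewrite (near_shift 0 x) /=; apply: filterS => y /=.
    by rewrite subr0.
  by apply: filterS2 => y /= fgy; rewrite !fctE /= fgy fgx.
have dgf := diff_unique (diff_continuous df) go.
by apply/diff_locallyP; rewrite dgf; split => //; exact: diff_continuous.
Qed.

Lemma class_C_eq V W k (f g : V -> W) U :
  open U -> (forall x, U x -> f x = g x) -> class_C k f U -> class_C k g U.
Proof.
move=> oU; elim: k f g => [|k IH] f g fg /=.
  by move=> cf x Ux; apply: near_eq_continuous (cf x Ux); exact: open_near_eq Ux.
move=> [df Df]; split=> [x Ux|v].
  by apply: near_eq_differentiable (df x Ux); exact: open_near_eq Ux.
apply: IH (Df v) => x Ux; apply: near_eq_derive; exact: open_near_eq Ux.
Qed.

Lemma class_C_cst V W k (c : W) (U : set V) : class_C k (fun=> c) U.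
Proof.
elim: k c => [|k IH] c /=; first by move=> x _; exact: cvg_cst.
split=> [x _|v]; first exact: differentiable_cst.
have -> : (fun x => 'D_v (fun=> c) x) = (fun=> 0 : W) :> (V -> W).
  by apply/funext => x; exact: derive_cst.
exact: IH.
Qed.

Lemma class_CD V W k (f g : V -> W) U : open U ->
  class_C k f U -> class_C k g U -> class_C k (fun x => f x + g x) U.
Proof.
move=> oU; elim: k f g => [|k IH] f g /=.
  by move=> cf cg x Ux; apply: cvgD; [exact: cf|exact: cg].
move=> [df Df] [dg Dg]; split=> [x Ux|v].
  by apply: differentiableD; [exact: df|exact: dg].
apply: class_C_eq oU _ (IH _ _ (Df v) (Dg v)) => x Ux.
rewrite -deriveD //; apply: diff_derivable; [exact: df|exact: dg].
Qed.

Lemma class_CM V k (f g : V -> R) U : open U ->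
  class_C k f U -> class_C k g U -> class_C k (fun x => f x * g x) U.
Proof.
move=> oU; elim: k f g => [|k IH] f g.
  by move=> cf cg x Ux; apply: cvgM; [exact: cf|exact: cg].
move=> Cf Cg; have [df Df] := Cf; have [dg Dg] := Cg; split=> [x Ux|v].
  by apply: differentiableM; [exact: df|exact: dg].
have := class_CD oU (IH _ _ (class_CS Cf) (Dg v)) (IH _ _ (class_CS Cg) (Df v)).
apply: class_C_eq => // x Ux.
by symmetry; apply: deriveM; apply: diff_derivable; [exact: df|exact: dg].
Qed.

Lemma class_C_sum V W k n (f : 'I_n -> V -> W) U : open U ->
  (forall i, class_C k (f i) U) -> class_C k (fun x => \sum_i f i x) U.
Proof.
move=> oU; elim: n f => [|n IH] f Cf.
  by under eq_fun do rewrite big_ord0; exact: class_C_cst.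
under eq_fun do rewrite big_ord_recl.
by apply: class_CD => //; apply: IH.
Qed.

Lemma class_CN V k (f : V -> R) U : open U ->
  class_C k f U -> class_C k (fun x => - f x) U.
Proof.
move=> oU Cf; have := class_CM oU (class_C_cst (W := R) k (-1) U) Cf.
by apply: class_C_eq => // x _; rewrite mulN1r.
Qed.

Lemma class_C_mx V m n k (f : V -> 'M[R]_(m, n)) U : open U ->
  (forall i j, class_C k (fun x => f x i j) U) -> class_C k f U.
Proof.
move=> oU; elim: k f => [|k IH] f Cf /=.
  move=> x Ux; apply/cvgrPdist_le => /= e e0; near=> y.
  rewrite /Num.Def.normr /= mx_normrE (bigmax_le _ (ltW e0))//= => -[i j] _.
  rewrite !mxE /=; move: i j; near: y.
  apply: filter_forall => /= i; apply: filter_forall => /= j.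
  by have := Cf i j x Ux => /cvgrPdist_le; apply.
have df x : U x -> differentiable f x.
  move=> Ux.
  have -> : f = \sum_i \sum_j (fun y => f y i j *: delta_mx i j).
    apply/funext => y; rewrite [LHS]matrix_sum_delta fct_sumE.
    by apply: eq_bigr => i _; rewrite fct_sumE.
  apply: differentiable_sum => i; apply: differentiable_sum => j.
  by apply: differentiableZl; have [+ _] := Cf i j; exact.
split=> // v; apply: IH => i j.
have [_ /(_ v)] := Cf i j; apply: class_C_eq => // x Ux.
by rewrite derive_mx ?mxE //; apply: diff_derivable; exact: df.
Unshelve. all: by end_near. Qed.

Lemma class_C_coord V m n k (f : V -> 'M[R]_(m, n)) U i j : open U ->
  class_C k f U -> class_C k (fun x => f x i j) U.
Proof.
move=> oU; elim: k f => [|k IH] f /=.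
  move=> cf x Ux; apply: (@continuous_comp _ _ _ f (fun M => M i j)).
    exact: cf.
  exact: coord_continuous.
move=> [df Df]; split=> [x Ux|v].
  apply: (@differentiable_comp _ _ _ _ f (fun M : 'M[R]_(m, n) => M i j)).
    exact: df.
  exact: differentiable_coord.
apply: class_C_eq oU _ (IH _ (Df v)) => x Ux.
by rewrite derive_mx ?mxE //; apply: diff_derivable; exact: df.
Qed.

Lemma class_C_id V k (U : set V) : class_C k (fun x : V => x) U.
Proof.
case: k => [|k] /=; first by move=> x _; exact: cvg_id.
split=> [x _|v]; first exact: (@ex_diff _ _ _ _ _ _ _ (is_diff_id x)).
have -> : (fun x : V => 'D_v (fun x => x) x) = (fun=> v) :> (V -> V).
  by apply/funext => x; exact: derive_id.
exact: class_C_cst.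
Qed.

Lemma class_C_mulmx V m n p k (f : V -> 'M[R]_(m, n)) (g : V -> 'M[R]_(n, p)) U :
  open U -> class_C k f U -> class_C k g U -> class_C k (fun x => f x *m g x) U.
Proof.
move=> oU Cf Cg; apply: class_C_mx => // i j.
have C q := class_CM oU (class_C_coord i q oU Cf) (class_C_coord q j oU Cg).
by apply: class_C_eq oU _ (class_C_sum oU C) => x _; rewrite mxE.
Qed.

Lemma mulmx_continuous m n p (M : 'M[R]_(m, n)) :
  continuous (mulmx M : 'M[R]_(n, p) -> 'M[R]_(m, p)).
Proof.
suff : class_C 0 (mulmx M : 'M[R]_(n, p) -> 'M[R]_(m, p)) setT by move=> + v; exact.
exact: (class_C_mulmx openT (class_C_cst _ M _) (@class_C_id _ _ _)).
Qed.

Lemma derive_comp V W W' (f : V -> W) (g : W -> W') x v :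
  differentiable f x -> differentiable g (f x) ->
  'D_v (g \o f) x = 'D_('D_v f x) g (f x).
Proof.
move=> df dg; rewrite !deriveE //; last exact: differentiable_comp.
by rewrite diff_comp.
Qed.

Lemma derive_cV W n (g : 'cV[R]_n -> W) x v : differentiable g x ->
  'D_v g x = \sum_i v i 0 *: 'D_(delta_mx i 0) g x.
Proof.
move=> dg; rewrite deriveE // [in LHS](matrix_sum_delta v) linear_sum.
by apply: eq_bigr => i _; rewrite big_ord1 linearZ /= deriveE.
Qed.

(** By the chain rule the derivative of the composite is a sum of products of
    components of the derivative of f with partial derivatives of g composed
    with f, so the induction on k closes. *)
Lemma class_C_comp V n k (f : V -> 'cV[R]_n) (g : 'cV[R]_n -> R) U U' :
  open U -> (forall x, U x -> U' (f x)) ->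
  class_C k f U -> class_C k g U' -> class_C k (g \o f) U.
Proof.
move=> oU UU'; elim: k f g UU' => [|k IH] f g UU'.
  move=> cf cg x Ux; apply: continuous_comp; [exact: cf|exact/cg/UU'].
move=> Cf [dg Dg]; have [df Df] := Cf; split=> [x Ux|v].
  by apply: differentiable_comp; [exact: df|exact/dg/UU'].
have H : class_C k
    (fun x => \sum_i ('D_v f x) i 0 * ('D_(delta_mx i 0) g \o f) x) U.
  apply: class_C_sum => // i; apply: class_CM => //.
    by apply: class_C_coord => //; exact: Df.
  by apply: IH => //; [exact: class_CS|exact: Dg].
apply: class_C_eq oU _ H => x Ux.
by rewrite [RHS]derive_comp ?derive_cV //; first [exact: df|exact/dg/UU'].
Qed.

Lemma class_C_compmx V n p q k (f : V -> 'cV[R]_n) (g : 'cV[R]_n -> 'M[R]_(p, q))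
    U U' :
  open U -> open U' -> (forall x, U x -> U' (f x)) ->
  class_C k f U -> class_C k g U' -> class_C k (g \o f) U.
Proof.
move=> oU oU' UU' Cf Cg; apply: class_C_mx => // i j.
exact: (class_C_comp (g := fun y => g y i j) oU UU' Cf (class_C_coord _ _ oU' Cg)).
Qed.

Lemma is_derive_comp1 V (f : V -> R) (g : R -> R) x v dg :
  differentiable f x -> is_derive (f x) 1 g dg ->
  is_derive x v (g \o f) (dg * 'D_v f x).
Proof.
move=> df [Dg Eg].
have dgx : differentiable g (f x) by exact/derivable1_diffP.
have dgf : differentiable (g \o f) x by exact: differentiable_comp.
apply: (DeriveDef (diff_derivable dgf)).
rewrite [LHS]derive_comp //.
have -> : 'D_v f x = 'D_v f x *: (1 : R) by rewrite [RHS]mulr1.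
rewrite [LHS]deriveE // [LHS]linearZ /= -deriveE // Eg.
by rewrite [in RHS]/GRing.scale /= mulr1 mulrC.
Qed.

(** One step of the induction on k for exp, cos, sin and the inverse, whose
    derivatives are built from the same functions. *)
Lemma class_C_comp1 V k (f : V -> R) (g g' : R -> R) U : open U ->
  (forall x, U x -> is_derive (f x) 1 g (g' (f x))) ->
  class_C k.+1 f U -> class_C k (g' \o f) U -> class_C k.+1 (g \o f) U.
Proof.
move=> oU dg Cf Cg'; have [df Df] := Cf.
split=> [x Ux|v].
  apply: differentiable_comp; first exact: df.
  by apply/derivable1_diffP; have [] := dg x Ux.
apply: class_C_eq oU _ (class_CM oU Cg' (Df v)) => x Ux.
by have [_ ->] := is_derive_comp1 v (df x Ux) (dg x Ux).
Qed.

Lemma class_C_expR V k (f : V -> R) U :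
  open U -> class_C k f U -> class_C k (expR \o f) U.
Proof.
move=> oU; elim: k => [|k IH] Cf.
  by move=> x Ux; apply: continuous_comp; [exact: Cf|exact: continuous_expR].
by apply: (class_C_comp1 (g := expR) oU _ Cf (IH (class_CS Cf))) => x _; exact: is_derive_expR.
Qed.

Lemma class_C_cos_sin V k (f : V -> R) U :
  open U -> class_C k f U -> class_C k (cos \o f) U /\ class_C k (sin \o f) U.
Proof.
move=> oU; elim: k => [|k IH] Cf.
  by split=> x Ux; apply: continuous_comp; (try exact: Cf);
     [exact: continuous_cos|exact: continuous_sin].
have [Cc Cs] := IH (class_CS Cf); split.
  exact: (class_C_comp1 (g := cos) (g' := fun a => - sin a) oU _ Cf
    (class_CN oU Cs)).
exact: (class_C_comp1 (g := sin) oU _ Cf Cc).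
Qed.

Lemma is_derive_inv (x : R) : x != 0 -> is_derive x 1 GRing.inv (- (x^-1 * x^-1)).
Proof.
move=> x0; apply: DeriveDef.
  exact: (derivableV (f := id)).
by rewrite (deriveV (f := id)) // derive_id expr2 invfM [LHS]mulr1.
Qed.

Lemma class_CV V k (f : V -> R) U : open U -> (forall x, U x -> f x != 0) ->
  class_C k f U -> class_C k (fun x => (f x)^-1) U.
Proof.
move=> oU f0; elim: k => [|k IH] Cf.
  by move=> x Ux; apply: cvgV; [exact: f0|exact: Cf].
have Ci := IH (class_CS Cf).
apply: (class_C_comp1 (g := GRing.inv) (g' := fun a => - (a^-1 * a^-1)) oU _ Cf) => [x Ux|].
  exact/is_derive_inv/f0.
exact: (class_CN oU (class_CM oU Ci Ci)).
Qed.

End ClassC.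

(** * Mean value theorem, partial derivatives, symmetry of second derivatives *)

Section MeanValue.
Context {R : realType}.
Implicit Types V W : normedModType R.

Lemma derivable_translate V W (f : V -> W) a x v :
  derivable f (x + a) v -> derivable (fun y => f (y + a)) x v.
Proof. by rewrite /derivable /=; under eq_fun do rewrite addrA. Qed.

Lemma derive_translate V W (f : V -> W) a x v :
  'D_v (fun y => f (y + a)) x = 'D_v f (x + a).
Proof.
rewrite /derive; set g := (X in lim (X @ _)).
suff -> : g = (fun h => h^-1 *: ((f \o shift (x + a)) (h *: v) - f (x + a))) by [].
by apply/funext => h; rewrite /g /= addrA.
Qed.

Lemma is_derive_line V W (f : V -> W) x v (t : R) :
  derivable f (x + t *: v) v ->
  is_derive t 1 (fun s => f (x + s *: v)) ('D_v f (x + t *: v)).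
Proof.
move=> df.
have E : (fun h : R => h^-1 *: (((fun s => f (x + s *: v)) \o shift t) (h *: 1)
           - f (x + t *: v)))
    = (fun h => h^-1 *: ((f \o shift (x + t *: v)) (h *: v) - f (x + t *: v))).
  apply/funext => h /=; congr (_ *: (f _ - _)).
  by rewrite scalerDl addrCA [h *: 1]mulr1.
by constructor; rewrite /derivable /derive E.
Qed.

Lemma continuous_line V (x v : V) : continuous (fun s : R => x + s *: v).
Proof. by move=> t; apply: cvgD; [exact: cvg_cst|exact: scalel_continuous]. Qed.

Lemma is_derive_coord V m n (f : V -> 'M[R]_(m, n)) x v d i j :
  is_derive x v f d -> is_derive x v (fun y => f y i j) (d i j).
Proof.
move=> [dv <-]; have dvij := (derivable_mxP _ _ _).1 dv i j.
by apply: (DeriveDef dvij); rewrite derive_mx // mxE.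
Qed.

Lemma continuous_near V (k : V -> R) x (e : R) : {for x, continuous k} -> 0 < e ->
  \forall z \near x, `|k z - k x| <= e.
Proof.
move=> /cvgrPdist_le ck e0; apply: filterS (ck e e0) => z.
by rewrite distrC.
Qed.

Lemma mvt_line V (f : V -> R) x v (c : R) :
  (forall t : R, `|t| <= `|c| -> derivable f (x + t *: v) v) ->
  exists2 t, `|t| <= `|c| & f (x + c *: v) - f x = c * 'D_v f (x + t *: v).
Proof.
move=> df; pose g s := f (x + s *: v).
have dg (t : R) : `|t| <= `|c| -> is_derive t 1 g ('D_v f (x + t *: v)).
  by move=> /df; exact: is_derive_line.
have cg (t : R) : `|t| <= `|c| -> {for t, continuous g}.
  move=> /dg[dgt _]; apply: differentiable_continuous.
  exact/derivable1_diffP.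
have g0 : g 0 = f x by rewrite /g scale0r addr0.
have [c0|c0|->] := ltgtP c 0; last first.
- by exists 0 => //; rewrite scale0r addr0 mul0r subrr.
- have bnd (t : R) : t \in `[0, c] -> `|t| <= `|c|.
    by rewrite in_itv /= => /andP[t0 tc]; rewrite !ger0_norm // ltW.
  have [t||t tin] := @MVT _ g (fun t => 'D_v f (x + t *: v)) 0 c c0.
  + by move=> /subset_itv_oo_cc tin; exact/dg/bnd.
    by apply: continuous_subspace_itv => t /bnd; exact: cg.
  + rewrite g0 subr0 mulrC => E; exists t => //.
    exact/bnd/subset_itv_oo_cc.
- have bnd (t : R) : t \in `[c, 0] -> `|t| <= `|c|.
    by rewrite in_itv /= => /andP[t0 tc]; rewrite !ler0_norm ?lerN2 // ltW.
  have [t||t tin] := @MVT _ g (fun t => 'D_v f (x + t *: v)) c 0 c0.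
  + by move=> /subset_itv_oo_cc tin; exact/dg/bnd.
  + by apply: continuous_subspace_itv => t /bnd; exact: cg.
  + rewrite g0 sub0r mulrN => E; exists t.
      exact/bnd/subset_itv_oo_cc.
    by rewrite mulrC -[RHS]opprK -E opprB.
Qed.

Lemma mvt_segment V (f : V -> R) x v :
  (forall t : R, 0 <= t <= 1 -> derivable f (x + t *: v) v) ->
  exists2 t, 0 <= t <= 1 & f (x + v) - f x = 'D_v f (x + t *: v).
Proof.
move=> df; pose g s := f (x + s *: v).
have dg (t : R) : 0 <= t <= 1 -> is_derive t 1 g ('D_v f (x + t *: v)).
  by move=> /df; exact: is_derive_line.
have [t||t tin] := @MVT _ g (fun t => 'D_v f (x + t *: v)) 0 1 ltr01.
- by rewrite in_itv /= => /andP[t0 t1]; apply: dg; rewrite !ltW.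
- apply: continuous_subspace_itv => t; rewrite in_itv /= => /dg[dgt _].
  exact/differentiable_continuous/derivable1_diffP.
- rewrite /g scale0r addr0 scale1r subr0 mulr1 => ->; exists t => //.
  by move: tin; rewrite in_itv /= => /andP[t0 t1]; rewrite !ltW.
Qed.

Lemma ler_mx_entry m n (M : 'M[R]_(m, n)) i j : `|M i j| <= `|M|.
Proof.
rewrite [leRHS]/Num.Def.normr /= mx_normrE.
exact: (le_bigmax _ (fun ij => `|M ij.1 ij.2|) (i, j)).
Qed.

Lemma ball_segment V (u0 u v : V) (r t : R) : 0 <= t <= 1 ->
  ball u0 r u -> ball u0 r v -> ball u0 r (v + t *: (u - v)).
Proof.
move=> /andP[t0 t1]; rewrite -!ball_normE /ball_ /= => bu bv.
have -> : u0 - (v + t *: (u - v)) = (1 - t) *: (u0 - v) + t *: (u0 - u).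
  rewrite scalerBl scale1r -[RHS]addrA [- _ + _]addrC -scalerBr opprB.
  by rewrite [u0 - u + _]addrC subrKA opprD addrA -scalerN opprB.
apply: le_lt_trans (ler_normD _ _) _; rewrite !normrZ (ger0_norm t0).
rewrite ger0_norm ?subr_ge0 //; move: bu bv.
set a := `|u0 - u|; set b := `|u0 - v| => ar br.
have mr : Num.max a b < r by rewrite gt_max ar br.
apply: le_lt_trans mr.
have am : 0 <= t * (Num.max a b - a) by rewrite mulr_ge0 // subr_ge0 le_max lexx.
have bm : 0 <= (1 - t) * (Num.max a b - b).
  by rewrite mulr_ge0 ?subr_ge0 // le_max lexx orbT.
lra.
Qed.

Lemma cV2_eta (v : 'cV[R]_2) : v = v 0 0 *: delta_mx 0 0 + v 1 0 *: delta_mx 1 0.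
Proof.
rewrite [LHS]matrix_sum_delta big_ord_recl big_ord1 !big_ord1.
by congr (_ *: delta_mx _ _ + v _ _ *: delta_mx _ _); apply/val_inj.
Qed.

(** A path from x to x + y parallel to the axes reduces the increment of f to
    the mean value theorem in one variable. *)
Lemma differentiable_partials (f : 'cV[R]_2 -> R) (w : 'I_2 -> 'cV[R]_2 -> R) U :
  open U -> (forall x i, U x -> is_derive x (delta_mx i 0) f (w i x)) ->
  (forall i, class_C 0 (w i) U) -> forall x, U x -> differentiable f x.
Proof.
move=> oU dfw cw x Ux.
pose L (v : 'cV[R]_2) : R := v 0 0 * w 0 x + v 1 0 * w 1 x.
have linL : linear L.
  by move=> a u v; rewrite /L !mxE /GRing.scale /=; ring.
pose LL := GRing.isLinear.Build _ _ _ _ _ linL.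
pose L' : {linear 'cV[R]_2 -> R} := HB.pack L LL.
have cL : continuous L'.
  suff : class_C 0 L setT by move=> + v; exact.
  have C i : class_C 0 (fun v : 'cV[R]_2 => v i 0 * w i x) setT.
    apply: class_CM (openT) (class_C_coord _ _ openT _) (class_C_cst _ _ _).
    exact: class_C_id.
  exact: (class_CD openT (C 0) (C 1)).
have fo : f \o shift x = cst (f x) + L' +o_ 0 id.
  apply/eqaddoP => _/posnumP[e].
  have : \forall z \near x, [/\ U z, `|w 0 z - w 0 x| <= e%:num / 2
                               & `|w 1 z - w 1 x| <= e%:num / 2].
    near=> z; split; near: z.
    - exact: open_nbhs_nbhs.
    - by apply: (@continuous_near _ (w 0)); [exact: cw|rewrite divr_gt0].
    - by apply: (@continuous_near _ (w 1)); [exact: cw|rewrite divr_gt0].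
  move=> /nbhs_ballP[r /= r0 br].
  apply/nbhs_ballP; exists r => //= y; rewrite mx_norm_ball /ball_ /= sub0r normrN => yr.
  have Hz (s t : R) : `|s| <= `|y 0 0| -> `|t| <= `|y 1 0| ->
      ball x r (x + s *: delta_mx 0 0 + t *: delta_mx 1 0).
    move=> sy ty; rewrite mx_norm_ball /ball_ /=.
    rewrite -addrA opprD addNKr normrN (le_lt_trans _ yr) //.
    rewrite [leLHS]/Num.Def.normr /= mx_normrE bigmax_le // => -[i j] _ /=.
    rewrite (ord1 j) !mxE; case: i => -[|[|//]] i2 /=.
      by rewrite !(mulr1, mulr0, addr0) (le_trans sy) // ler_mx_entry.
    by rewrite !(mulr1, mulr0, add0r) (le_trans ty) // ler_mx_entry.
  have Hz0 (s : R) : `|s| <= `|y 0 0| -> ball x r (x + s *: delta_mx 0 0).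
    move=> sy; rewrite -[_ + _]addr0 -(scale0r (delta_mx 1 0)).
    by apply: Hz; rewrite ?normr0.
  have [s sy Es] : exists2 s : R, `|s| <= `|y 0 0| &
      f (x + y 0 0 *: delta_mx 0 0) - f x
        = y 0 0 * w 0 (x + s *: delta_mx 0 0).
    have [s|s sy ->] := @mvt_line _ f x (delta_mx 0 0) (y 0 0).
      by move=> /Hz0/br[Uz _ _]; have [] := dfw _ 0 Uz.
    by exists s => //; have /br[Uz _ _] := Hz0 s sy; have [_ ->] := dfw _ 0 Uz.
  have [t ty Et] : exists2 t : R, `|t| <= `|y 1 0| &
      f (x + y 0 0 *: delta_mx 0 0 + y 1 0 *: delta_mx 1 0)
        - f (x + y 0 0 *: delta_mx 0 0)
        = y 1 0 * w 1 (x + y 0 0 *: delta_mx 0 0 + t *: delta_mx 1 0).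
    have [t|t ty ->] := @mvt_line _ f (x + y 0 0 *: delta_mx 0 0) (delta_mx 1 0) (y 1 0).
      by move=> /(Hz _ _ (lexx _))/br[Uz _ _]; have [] := dfw _ 1 Uz.
    exists t => //; have /br[Uz _ _] := Hz _ t (lexx _) ty.
    by have [_ ->] := dfw _ 1 Uz.
  have /br[_ S0 _] := Hz0 s sy.
  have /br[_ _ S1] := Hz _ t (lexx _) ty.
  rewrite [X in `|X|](_ : _ =
      y 1 0 * (w 1 (x + y 0 0 *: delta_mx 0 0 + t *: delta_mx 1 0) - w 1 x)
      + y 0 0 * (w 0 (x + s *: delta_mx 0 0) - w 0 x)); last first.
    rewrite -[LHS]/(f (y + x) - (f x + L y)) [y + x]addrC {1}(cV2_eta y) addrA /L.
    by rewrite !mulrBr -Et -Es; ring.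
  rewrite (le_trans (ler_normD _ _)) // !normrM.
  rewrite [in leRHS](splitr e%:num) mulrDl.
  apply: lerD; rewrite [leRHS]mulrC; apply: ler_pM => //; exact: ler_mx_entry.
have dL := diff_unique cL fo.
by apply/diff_locallyP; rewrite dL.
Unshelve. all: by end_near. Qed.

(** The mean value theorem used twice expresses the second difference of f along
    v and w as a value, near x, of the iterated derivative k. *)
Lemma second_difference V (f g k : V -> R) U x (v w : V) (e : R) :
  open U -> U x -> (forall y, U y -> is_derive y v f (g y)) ->
  (forall y, U y -> is_derive y w g (k y)) -> {for x, continuous k} -> 0 < e ->
  exists2 d, 0 < d & forall h, 0 < h < d ->
   `| f (x + h *: v + h *: w) - f (x + h *: v) - (f (x + h *: w) - f x)
      - h ^+ 2 * k x| <= h ^+ 2 * e.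
Proof.
move=> oU Ux df dg ck e0.
have : \forall z \near x, U z /\ `|k z - k x| <= e.
  near=> z; split; near: z; first exact: open_nbhs_nbhs.
  exact: continuous_near.
move=> /nbhs_ballP[r /= r0 br].
pose M := `|v| + `|w| + 1.
have M0 : 0 < M by rewrite ltr_wpDl // addr_ge0.
exists (r / M); first exact: divr_gt0.
move=> h /andP[h0]; rewrite ltr_pdivlMr // => hM.
have B (s t : R) : `|s| <= `|h| -> `|t| <= `|h| -> ball x r (x + s *: v + t *: w).
  rewrite (gtr0_norm h0) => sh th; rewrite -ball_normE /ball_ /=.
  rewrite -addrA opprD addNKr normrN (le_lt_trans _ hM) //.
  rewrite (le_trans (ler_normD _ _)) // !normrZ /M 2!mulrDr -addrA.
  by rewrite lerD ?ler_wpM2r // (le_trans (ler_wpM2r _ th)) // lerDl mulr_ge0 // ltW.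
have B0 (s : R) : `|s| <= `|h| -> ball x r (x + s *: v).
  by move=> sh; rewrite -[_ + _]addr0 -(scale0r w); apply: B; rewrite ?normr0.
pose q y := f (y + h *: w) - f y.
have dq (t : R) : `|t| <= `|h| -> is_derive (x + t *: v) v q
    (g (x + t *: v + h *: w) - g (x + t *: v)).
  move=> th; have [U1 _] := br _ (B0 t th); have [U2 _] := br _ (B t h th (lexx _)).
  have [D2 E2] := df _ U2.
  apply: is_deriveB; last exact: df.
  by apply: (DeriveDef (derivable_translate D2)); rewrite derive_translate.
have [t|t th] := @mvt_line _ q x v h; first by move=> /dq[].
have [_ ->] := dq t th => E1.
have [s|s sh E2] := @mvt_line _ g (x + t *: v) w h.
  by move=> sh; have [U1 _] := br _ (B t s th sh); have [] := dg _ U1.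
have [U3 ks] := br _ (B t s th sh); have [_ E3] := dg _ U3.
rewrite E2 E3 in E1.
have -> : f (x + h *: v + h *: w) - f (x + h *: v) - (f (x + h *: w) - f x)
  = h * (h * k (x + t *: v + s *: w)) := E1.
rewrite mulrA -expr2 -mulrBr normrM (gtr0_norm (exprn_gt0 2 h0)).
by rewrite ler_pM2l // exprn_gt0.
Unshelve. all: by end_near. Qed.

(** The second difference along v and w is symmetric in v and w, and h ^ 2 times
    either iterated derivative approximates it. *)
Lemma derive_comm V (f : V -> R) U x v w :
  open U -> class_C 2 f U -> U x -> 'D_w ('D_v f) x = 'D_v ('D_w f) x.
Proof.
move=> oU Cf Ux.
have D1 u y : U y -> is_derive y u f ('D_u f y).
  by move=> Uy; apply/derivableP/diff_derivable; case: Cf => + _; exact.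
have D2 u u' y : U y -> is_derive y u' ('D_u f) ('D_u' ('D_u f) y).
  move=> Uy; apply/derivableP/diff_derivable.
  by case: Cf => _ /(_ u)[+ _]; exact.
have D3 u u' : {for x, continuous ('D_u' ('D_u f))}.
  by case: Cf => _ /(_ u)[_ /(_ u')]; exact.
suff uniq (a b : R) (A B : R -> R) : (forall h, A h = B h) ->
    (forall e, 0 < e -> exists2 d, 0 < d & forall h, 0 < h < d ->
      `|A h - h ^+ 2 * a| <= h ^+ 2 * e) ->
    (forall e, 0 < e -> exists2 d, 0 < d & forall h, 0 < h < d ->
      `|B h - h ^+ 2 * b| <= h ^+ 2 * e) -> a = b.
  apply: uniq (fun e => second_difference oU Ux (D1 v) (D2 v w) (D3 v w))
    (fun e => second_difference oU Ux (D1 w) (D2 w v) (D3 w v)) => h /=.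
  by rewrite [x + h *: w + h *: v]addrAC; ring.
move=> AB HA HB; apply/eqP; rewrite -subr_eq0 -normr_le0.
apply/ler_addgt0Pl => e e0; rewrite addr0.
have e2 : 0 < e / 2 by rewrite divr_gt0.
have [d1 d10 H1] := HA _ e2; have [d2 d20 H2] := HB _ e2.
pose h := Num.min d1 d2 / 2.
have m0 : 0 < Num.min d1 d2 by rewrite lt_min d10.
have h0 : 0 < h by rewrite divr_gt0.
have hm : h < Num.min d1 d2 by rewrite ltr_pdivrMr // mulr2n mulrDr mulr1 ltrDl.
have /andP[h1 h2] : (h < d1) && (h < d2) by rewrite -lt_min.
have {}H1 := H1 h ltac:(by rewrite h0 h1).
have {}H2 := H2 h ltac:(by rewrite h0 h2).
rewrite -(ler_pM2l (exprn_gt0 2 h0)) -[h ^+ 2 in leLHS]gtr0_norm ?exprn_gt0 //.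
rewrite -normrM [e in leRHS](splitr e) [leRHS]mulrDr.
have -> : h ^+ 2 * (a - b) = (B h - h ^+ 2 * b) - (A h - h ^+ 2 * a).
  by rewrite AB; ring.
exact: le_trans (ler_normB _ _) (lerD H2 H1).
Qed.

End MeanValue.

HB.instance Definition _ (R : realType) m n := Complete.on 'M[R]_(m, n).

(** * The inverse function theorem in the plane *)

Section InverseFunction.
Context {R : realType}.
Local Notation vec := ('cV[R]_2).

Definition jac m n (G : 'cV[R]_m -> 'cV[R]_n) u : 'M[R]_(n, m) :=
  \matrix_(i, j) ('D_(delta_mx j 0) G u) i 0.

Lemma jacE m n (G : 'cV[R]_m -> 'cV[R]_n) u v :
  differentiable G u -> 'D_v G u = jac G u *m v.
Proof.
move=> dG; rewrite derive_cV //; apply/colP => i.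
rewrite !mxE summxE; apply: eq_bigr => j _.
by rewrite !mxE mulrC.
Qed.

Lemma ler_cV n (v : 'cV[R]_n) c : 0 <= c -> (forall i, `|v i 0| <= c) -> `|v| <= c.
Proof.
move=> c0 vc; rewrite [leLHS]/Num.Def.normr /= mx_normrE bigmax_le // => -[i j] _ /=.
by rewrite (ord1 j).
Qed.

(** Cramer's rule; 1 - i is the index of 'I_2 other than i. *)
Definition inv2 (M : 'M[R]_2) : 'M[R]_2 :=
  (M 0 0 * M 1 1 - M 0 1 * M 1 0)^-1 *:
  \matrix_(i, j) (if i == j then M (1 - i) (1 - j) else - M i j).

Lemma I2P (P : 'I_2 -> Prop) : P 0 -> P 1 -> forall i, P i.
Proof.
move=> P0 P1 [[|[|//]] i2].
- by rewrite (_ : Ordinal i2 = 0) //; exact/val_inj.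
- by rewrite (_ : Ordinal i2 = 1) //; exact/val_inj.
Qed.

Lemma sum2 (V : nmodType) (f : 'I_2 -> V) : \sum_i f i = f 0 + f 1.
Proof. by rewrite big_ord_recl big_ord1; congr (_ + f _); exact/val_inj. Qed.

(** If the determinant vanished, the columns of the adjugate would lie in the
    kernel. *)
Lemma inv2P (M : 'M[R]_2) : (forall v : vec, M *m v = 0 -> v = 0) ->
  M 0 0 * M 1 1 - M 0 1 * M 1 0 != 0 /\ forall v : vec, inv2 M *m (M *m v) = v.
Proof.
move=> inj; have d0 : M 0 0 * M 1 1 - M 0 1 * M 1 0 != 0.
  apply/eqP => d0.
  have K (a b : R) : M 0 0 * a + M 0 1 * b = 0 -> M 1 0 * a + M 1 1 * b = 0 ->
      a = 0 /\ b = 0.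
    move=> E0 E1; pose v : vec := \col_i (if i == 0 then a else b).
    have /inj v0 : M *m v = 0.
      by apply/colP; apply: I2P; rewrite !mxE sum2 !mxE /=.
    by have := congr1 (fun v : vec => (v 0 0, v 1 0)) v0; rewrite !mxE /= => -[].
  have [M11 M10] := K (M 1 1) (- M 1 0) ltac:(by rewrite -d0; ring) ltac:(ring).
  have [M01 M00] := K (- M 0 1) (M 0 0) ltac:(ring) ltac:(by rewrite -d0; ring).
  have [/eqP] := K 1 0 ltac:(by rewrite M00; ring)
    ltac:(by move/eqP: M10; rewrite oppr_eq0 => /eqP->; ring).
  by rewrite oner_eq0.
split=> // v; rewrite mulmxA.
suff -> : inv2 M *m M = 1%:M by rewrite mul1mx.
apply/matrixP; apply: I2P; apply: I2P;
  by rewrite !mxE sum2 !mxE /= ?subr0 ?subrr; field.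
Qed.

Lemma class_C_jac (G : vec -> vec) k U : open U ->
  class_C k.+1 G U -> class_C k (jac G) U.
Proof.
move=> oU [_ DG]; apply: class_C_mx => // i j.
apply: class_C_eq oU _ (class_C_coord i 0 oU (DG (delta_mx j 0))) => x _.
by rewrite mxE.
Qed.

Lemma class_C_inv2 (V : normedModType R) k (M : V -> 'M[R]_2) U : open U ->
  (forall x, U x -> M x 0 0 * M x 1 1 - M x 0 1 * M x 1 0 != 0) ->
  class_C k M U -> class_C k (fun x => inv2 (M x)) U.
Proof.
move=> oU d0 CM; have C i j := class_C_coord i j oU CM.
apply: class_C_mx => // i j.
have Cd := class_CV oU d0 (class_CD oU (class_CM oU (C 0 0) (C 1 1))
   (class_CN oU (class_CM oU (C 0 1) (C 1 0)))).
have Ce : class_C k (fun x => if i == j then M x (1 - i) (1 - j) else - M x i j) U.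
  by case: (i == j); [exact: C|exact: class_CN].
by apply: class_C_eq oU _ (class_CM oU Cd Ce) => x _; rewrite !mxE.
Qed.

Lemma ball_cV2 (u0 u : vec) (r : R) : 0 < r ->
  ball u0 r u <-> `|u0 0 0 - u 0 0| < r /\ `|u0 1 0 - u 1 0| < r.
Proof.
move=> r0; split=> [[_ H]|[H0 H1]]; first by split; exact: H.
by split=> // i j; rewrite (ord1 j); move: i; apply: I2P.
Qed.

(** Near a point where its derivative is the identity, G differs from the
    identity by a contraction. *)
Lemma near_identity (G : vec -> vec) D u0 : open D -> D u0 -> class_C 1 G D ->
  (forall v, 'D_v G u0 = v) ->
  exists2 r, 0 < r & [/\ ball u0 r `<=` D,
    forall u v, ball u0 r u -> ball u0 r v ->
      `|G u - G v - (u - v)| <= 2^-1 * `|u - v|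
    & forall u v, ball u0 r u -> `|'D_v G u - v| <= 2^-1 * `|v| ].
Proof.
move=> oD Du0 CG Gid; have dG u := class_C_differentiable (x := u) CG.
(* with two variables and the sup norm, 1/4 on the entries gives 1/2 on vectors *)
have : \forall u \near u0, D u /\ forall j i,
    `|('D_(delta_mx j 0) G u) i 0 - (delta_mx j 0 : vec) i 0| <= 4^-1.
  near=> u; split; near: u; first exact: open_nbhs_nbhs.
  apply: filter_forall => j; apply: filter_forall => i.
  have cji := class_C_coord i 0 oD (class_C_derive (delta_mx j 0) CG).
  have := continuous_near (cji u0 Du0) (_ : 0 < 4^-1).
  by rewrite Gid; apply.
move=> /nbhs_ballP[r /= r0 br]; exists r => //.
have Dle u v : ball u0 r u -> `|'D_v G u - v| <= 2^-1 * `|v|.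
  move=> /br[Du Dg].
  have dGu := dG _ Du; apply: ler_cV => [|i]; first exact: mulr_ge0.
  have -> : ('D_v G u - v) i 0 =
      \sum_j v j 0 * (('D_(delta_mx j 0) G u) i 0 - (delta_mx j 0 : vec) i 0).
    rewrite derive_cV // {2}[v](matrix_sum_delta) !mxE !summxE -sumrB.
    by apply: eq_bigr => j _; rewrite big_ord1 !mxE mulrBr.
  rewrite sum2 (le_trans (ler_normD _ _)) // !normrM.
  have -> : 2^-1 * `|v| = `|v| * 4^-1 + `|v| * 4^-1 by field.
  by apply: lerD; apply: ler_pM => //; exact: ler_mx_entry.
split=> // [u /br[]//|u v bu bv].
apply: ler_cV => [|i]; first exact: mulr_ge0.
pose H z : R := G z i 0 + -1 * z i 0.
have bt (t : R) : 0 <= t <= 1 -> ball u0 r (v + t *: (u - v)).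
  by move=> t01; exact: ball_segment.
have dH z w : ball u0 r z -> is_derive z w H (('D_w G z - w) i 0).
  move=> bz; have dGz : derivable G z w by apply/diff_derivable/dG; have [] := br _ bz.
  have dGi := is_derive_coord i 0 (derivableP dGz).
  have di := is_derive_coord i 0 (is_derive_id z w).
  by have := is_deriveD dGi (is_deriveZ (-1) di); rewrite !mxE scaleN1r.
have [t|t t01] := @mvt_segment _ _ H v (u - v).
  by move=> /bt bz; have [] := dH _ (u - v) bz.
have [_ ->] := dH _ (u - v) (bt _ t01).
rewrite [v + (u - v)]addrC subrK => E.
have -> : (G u - G v - (u - v)) i 0 = H u - H v.
  by rewrite !mxE /H; ring.
rewrite E; apply: le_trans (Dle _ _ (bt _ t01)); exact: ler_mx_entry.
Unshelve. all: by end_near. Qed.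

(** A solution of G u = w is a fixed point of u - G u + w.  This map contracts by
    1/2 and moves u0 by less than r / 4, so it preserves the closed ball of radius
    r / 2. *)
Lemma near_identity_surj (G : vec -> vec) u0 r w : 0 < r ->
  (forall u v, ball u0 r u -> ball u0 r v ->
    `|G u - G v - (u - v)| <= 2^-1 * `|u - v|) ->
  `|w - G u0| < r / 4 -> exists2 u, ball u0 r u & G u = w.
Proof.
move=> r0 Gc wr; pose A : set vec := closed_ball_ Num.norm u0 (r / 2).
have Ab u : A u -> ball u0 r u.
  rewrite /A /closed_ball_ /= -ball_normE /ball_ /= => /le_lt_trans; apply.
  by rewrite ltr_pdivrMr // ltr_pMr // ltr1n.
pose T (u : vec) : vec := u - G u + w.
have TA : set_fun A A T.
  move=> u Au; rewrite /A /= /T.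
  rewrite /closed_ball_ /=.
  have -> : u0 - (u - G u + w) = (G u - G u0 - (u - u0)) - (w - G u0).
    by apply/colP => i; rewrite !mxE; ring.
  rewrite (le_trans (ler_normB _ _)) //.
  have := Gc _ _ (Ab _ Au) (ballxx u0 r0).
  have := Au : `|u0 - u| <= r / 2; rewrite [`|u0 - u|]distrC; lra.
pose TF := isFun.Build _ _ A A T TA.
pose T' : {fun A >-> A} := HB.pack T TF.
have ctr : is_contraction T'.
  exists (2^-1)%:nng; split => /=; first by rewrite invf_lt1 // ltr1n.
  move=> [u v] /= [Au Av].
  have -> : T u - T v = - (G u - G v - (u - v)).
    by apply/colP => i; rewrite !mxE; ring.
  by rewrite normrN; exact: Gc (Ab _ Au) (Ab _ Av).
have cA : closed A by exact: closed_closed_ball_.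
have [|u Au uT] := banach_fixed_point ctr cA.
  by exists u0; rewrite /A /closed_ball_ /= subrr normr0 divr_ge0 // ltW.
exists u; first exact: Ab.
move: uT; rewrite [T' u]/(u - G u + w) => /(congr1 (fun z => G u - u + z)).
by rewrite subrK addrA subrKA subrr add0r.
Qed.

Lemma ler_mulmx2 (M : 'M[R]_2) (v : vec) : `|M *m v| <= 2 * `|M| * `|v|.
Proof.
apply: ler_cV => [|i]; first by rewrite !mulr_ge0.
rewrite mxE sum2 (le_trans (ler_normD _ _)) // !normrM -mulrA mulr2n mulrDl mul1r.
by apply: lerD; apply: ler_pM => //; exact: ler_mx_entry.
Qed.

(** The inverse K is Lipschitz because G is close to the identity; hence the
    expansion of G at K w inverts to one of K at w, with derivative J w, the inverse
    of the Jacobian of G at K w.  As J is K followed by a C^k map, the regularity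
    of K improves by one step at a time. *)
Lemma local_inverse (G : vec -> vec) D u0 k : open D -> D u0 ->
  class_C k.+1 G D -> (forall v, 'D_v G u0 = v) ->
  exists D0 B K, [/\ open_nbhs u0 D0 /\ D0 `<=` D, open_nbhs (G u0) B,
    class_C k.+1 K B, forall w, B w -> D0 (K w) /\ G (K w) = w
    & forall u, D0 u -> B (G u) /\ K (G u) = u].
Proof.
move=> oD Du0 CG Gid.
have C1G : class_C 1 G D := class_C_le (ltn0Sn k) CG.
have [r r0 [brD Gc Dc]] := near_identity oD Du0 C1G Gid.
pose B : set vec := ball (G u0) (r / 4).
pose D0 := ball u0 r `&` (G @^-1` B).
pose K w := xget u0 [set u | ball u0 r u /\ G u = w].
have dG u := class_C_differentiable (x := u) CG.
have r4 : 0 < r / 4 by exact: divr_gt0.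
have Glow u v : ball u0 r u -> ball u0 r v -> `|u - v| <= 2 * `|G u - G v|.
  move=> bu bv; have := Gc _ _ bu bv.
  have := ler_normB (G u - G v) (G u - G v - (u - v)).
  rewrite opprB addrCA subrr addr0; lra.
have inj u v : ball u0 r u -> ball u0 r v -> G u = G v -> u = v.
  move=> bu bv E; have := Glow u v bu bv.
  by rewrite E subrr normr0 mulr0 normr_le0 subr_eq0 => /eqP.
have KP w : B w -> ball u0 r (K w) /\ G (K w) = w.
  move=> Bw; have {}Bw : `|w - G u0| < r / 4.
    by move: Bw; rewrite /B -ball_normE /ball_ /= distrC.
  have [u bu Gu] := near_identity_surj r0 Gc Bw.
  suff : [set u | ball u0 r u /\ G u = w] (K w) by exact.
  by apply: xgetPex; exists u.
have KG u : D0 u -> K (G u) = u.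
  move=> [bu Bu]; have [bK GK] := KP _ Bu; exact: inj.
have oB : open B by exact: ball_open.
have oD0 : open D0.
  rewrite openE => u [bu Bu]; apply: filterI.
    by apply: open_nbhs_nbhs; split => //; exact: ball_open.
  apply: (differentiable_continuous (dG u (brD _ bu))).
  exact: open_nbhs_nbhs.
have D0D : D0 `<=` D by move=> u [/brD].
have D0K w : B w -> D0 (K w).
  by move=> Bw; have [bK GK] := KP w Bw; split; rewrite //= GK.
have Klip w w' : B w -> B w' -> `|K w - K w'| <= 2 * `|w - w'|.
  move=> /KP[bw Gw] /KP[bw' Gw']; have := Glow _ _ bw bw'.
  by rewrite Gw Gw'.
have jinj u : D0 u -> forall v : vec, jac G u *m v = 0 -> v = 0.
  move=> D0u v; rewrite -jacE; last exact/dG/D0D.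
  move=> E; have := Dc u v D0u.1; rewrite E sub0r normrN => H.
  apply/eqP; rewrite -normr_eq0; apply/eqP/le_anti; rewrite normr_ge0 andbT; lra.
pose J w := inv2 (jac G (K w)).
have Jk w (v : vec) : B w -> J w *m (jac G (K w) *m v) = v.
  by move=> Bw; have [_ ->] := inv2P (jinj _ (D0K w Bw)).
have KD w : B w -> K \o shift w = cst (K w) + mulmx (J w) +o_ 0 id.
  move=> Bw; apply/eqaddoP => e e0; set u := K w.
  have dGu : differentiable G u by exact/dG/D0D/D0K.
  pose c := 2 * `|J w| + 1.
  have c0 : 0 < c by rewrite ltr_wpDl // mulr_ge0.
  have Lc (v : vec) : `|J w *m v| <= c * `|v|.
    by rewrite (le_trans (ler_mulmx2 _ _)) // ler_wpM2r // lerDl.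
  have e' : 0 < e / (2 * c) by rewrite divr_gt0 // mulr_gt0.
  have /eqaddoP/(_ _ e')/nbhs_ballP[d /= d0 Gd] := diff_locally dGu.
  have [q /= q0 qB] := (nbhs_ballP _ _).1 (open_nbhs_nbhs (conj oB Bw)).
  have m0 : 0 < Num.min q (d / 2) by rewrite lt_min q0 divr_gt0.
  apply/nbhs_ballP; exists (Num.min q (d / 2)) => //= h.
  rewrite -ball_normE /ball_ /= sub0r normrN lt_min => /andP[hq hd].
  have Bh : B (h + w).
    by apply: qB; rewrite -ball_normE /ball_ /= opprD addrCA subrr addr0 normrN.
  pose z := K (h + w) - u.
  have zh : `|z| <= 2 * `|h| by have := Klip _ _ Bh Bw; rewrite addrK.
  have zd : ball 0 d z.
    by rewrite -ball_normE /ball_ /= sub0r normrN (le_lt_trans zh) // mulrC -ltr_pdivlMr.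
  (* the error of K at w is the image under - J w of the error of G at u *)
  have {Gd} := Gd z zd.
  rewrite [X in `|X|](_ : _ = h - jac G u *m z); last first.
    rewrite -[LHS]/(G (z + u) - (G u + 'd G u z)) -deriveE // jacE //.
    have [_ E1] := KP _ Bh; have [_ E2] := KP _ Bw.
    by rewrite /z subrK E1 /u E2 opprD addrA addrK.
  move=> Gz.
  rewrite [X in `|X|](_ : _ = - (J w *m (h - jac G u *m z))); last first.
    rewrite -[LHS]/(K (h + w) - (u + J w *m h)) mulmxBr /u Jk //.
    by rewrite opprB opprD addrA.
  rewrite normrN (le_trans (Lc _)) // (le_trans (ler_wpM2l (ltW c0) Gz)) //.
  have -> : e * `|h| = c * (e / (2 * c) * (2 * `|h|)) by field; rewrite gt_eqF.
  by rewrite ler_pM2l // ler_pM2l.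
have KdE w : B w -> 'd K w = mulmx (J w) :> (vec -> vec).
  by move=> Bw; exact: diff_unique (@mulmx_continuous _ _ _ _ _) (KD w Bw).
have Kd w : B w -> differentiable K w.
  move=> Bw; apply/diff_locallyP; rewrite KdE //; split; last exact: KD.
  exact: mulmx_continuous.
have CK j : (j <= k.+1)%N -> class_C j K B.
  elim: j => [_ w Bw|j IH jk]; first exact/differentiable_continuous/Kd.
  have CJ : class_C j J B.
    apply: class_C_inv2 => // [w Bw|]; first by have [] := inv2P (jinj _ (D0K w Bw)).
    apply: (class_C_compmx oB oD0 D0K (IH (ltnW jk))).
    have jk' : (j <= k)%N by [].
    exact: class_C_subset D0D (class_C_le jk' (class_C_jac oD CG)).
  split=> [//|v].
  apply: class_C_eq oB _ (class_C_mulmx oB CJ (class_C_cst j v B)) => w Bw.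
  by rewrite deriveE ?KdE //; exact: Kd.
exists D0, B, K; split => //.
- by split=> //; split=> //; split; [exact: ballxx|exact: ballxx].
- by split=> //; exact: ballxx.
- exact: CK.
- by move=> w Bw; split; [exact: D0K|have [] := KP w Bw].
- by move=> u D0u; split; [case: D0u|exact: KG].
Qed.

Lemma derive_mulmx (V : normedModType R) m n p (M : 'M[R]_(m, n))
    (f : V -> 'M[R]_(n, p)) x v :
  differentiable f x -> 'D_v (fun y => M *m f y) x = M *m 'D_v f x.
Proof.
move=> df.
have dM y : differentiable (mulmx M : 'M[R]_(n, p) -> 'M[R]_(m, p)) y.
  exact/linear_differentiable/mulmx_continuous.
rewrite (derive_comp (f := f) (g := mulmx M) v df (dM _)) deriveE // diff_lin //.
exact: mulmx_continuous.
Qed.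

(** An immersion of a plane domain has a left inverse defined on an open set of
    space: compose it with a linear left inverse of its derivative and invert the
    resulting map of the plane. *)
Lemma immersion_left_inverse n k (Y : vec -> 'cV[R]_n) D u0 (M : 'M[R]_(2, n)) :
  open D -> D u0 -> class_C k.+1 Y D ->
  (forall v, M *m 'D_v Y u0 = v) ->
  exists D0 V0 Z, [/\ open_nbhs u0 D0 /\ D0 `<=` D, open V0, class_C k.+1 Z V0,
    forall q, V0 q -> D0 (Z q) & forall u, D0 u -> V0 (Y u) /\ Z (Y u) = u].
Proof.
move=> oD Du0 CY MY.
have CG : class_C k.+1 (fun u => M *m Y u) D.
  exact: class_C_mulmx oD (class_C_cst _ _ _) CY.
have [v|D0 [B [K [nD0 [oB _] CK BK D0K]]]] := local_inverse oD Du0 CG.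
  by rewrite derive_mulmx //; exact: (class_C_differentiable CY).
have oV : open (mulmx M @^-1` B : set 'cV[R]_n).
  by apply: open_comp => // q _; exact: mulmx_continuous.
exists D0, (mulmx M @^-1` B), (K \o mulmx M); split => //.
- apply: (class_C_compmx oV oB _ _ CK) => //.
  exact: class_C_mulmx oV (class_C_cst _ _ _) (@class_C_id _ _ _ _).
- by move=> q /BK[].
Qed.

End InverseFunction.

(** * The Poincare lemma in the plane *)

Section Poincare.
Context {R : realType}.
Local Notation mu := (@lebesgue_measure R).

Lemma continuous_oo_integrable (f : R -> R) (x1 x2 a b : R) :
  (forall s, x1 < s < x2 -> {for s, continuous f}) -> x1 < a -> b < x2 ->
  {within `[a, b], continuous f} /\ mu.-integrable `[a, b] (EFin \o f).
Proof.
move=> cf xa bx; have cab : {within `[a, b], continuous f}.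
  apply: continuous_subspace_itv => s; rewrite in_itv /= => /andP[as_ sb].
  by apply: cf; rewrite (lt_le_trans xa as_) (le_lt_trans sb bx).
by split=> //; apply: continuous_compact_integrable => //; exact: segment_compact.
Qed.

Lemma is_derive_Rintegral (f : R -> R) (x1 x2 a x : R) :
  (forall s, x1 < s < x2 -> {for s, continuous f}) -> x1 < a -> a < x < x2 ->
  is_derive x 1 (fun x => \int[mu]_(s in `[a, x]) f s) (f x).
Proof.
move=> cf xa /andP[ax xx].
pose u := (x + x2) / 2.
have xu : x < u by rewrite ltr_pdivlMr //; lra.
have ux : u < x2 by rewrite ltr_pdivrMr //; lra.
have [_ fi] := continuous_oo_integrable cf xa ux.
have fx : {for x, continuous f} by apply: cf; rewrite (lt_trans xa ax).
have [D E] := continuous_FTC1_closed xu fi ax fx.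
by apply: (DeriveDef D); rewrite -derive1E.
Qed.

Lemma Rintegral_derive (f F : R -> R) (x1 x2 a b : R) :
  (forall s, x1 < s < x2 -> {for s, continuous f}) ->
  (forall s, x1 < s < x2 -> is_derive s 1 F (f s)) -> x1 < a -> a < b < x2 ->
  \int[mu]_(s in `[a, b]) f s = F b - F a.
Proof.
move=> cf dF xa /andP[ab bx].
have [cab _] := continuous_oo_integrable cf xa bx.
have cF (s : R) : x1 < s < x2 -> {for s, continuous F}.
  by move=> /dF[Ds _]; exact/differentiable_continuous/derivable1_diffP.
have io (s : R) : s \in `]a, b[ -> x1 < s < x2.
  by rewrite in_itv /= => /andP[as_ sb]; rewrite (lt_trans xa as_) (lt_trans sb bx).
rewrite /Rintegral (@continuous_FTC2 _ f F a b ab cab) //.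
- split=> [s /io/dF[]//||].
  + apply: cvg_at_right_filter; apply: cF; rewrite xa; exact: lt_trans bx.
  + apply: cvg_at_left_filter; apply: cF; rewrite bx andbT; exact: lt_trans ab.
- by move=> s /io/dF[_ <-]; rewrite derive1E.
Qed.

(** The integrals run along the two sides of a rectangle; moving its corner in
    the first direction changes the second integral by the integral of
    dq/dx = dp/dy, hence by an increment of p. *)
Lemma rectangle_primitive (p q d : R -> R -> R) (x1 x2 y1 y2 xb yb C x y : R) :
  (forall x y, x1 < x < x2 -> y1 < y < y2 ->
    [/\ is_derive y 1 (p x) (d x y), is_derive x 1 (q ^~ y) (d x y),
        {for x, continuous (p ^~ y)}, {for y, continuous (q x)} &
        {for y, continuous (d x)} /\ `|d x y| <= C]) ->
  x1 < xb -> xb < x < x2 -> y1 < yb -> yb < y < y2 ->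
  let a x y := \int[mu]_(s in `[xb, x]) p s yb + \int[mu]_(t in `[yb, y]) q x t in
  is_derive x 1 (a ^~ y) (p x y) /\ is_derive y 1 (a x) (q x y).
Proof.
move=> H x1b /andP[xbx xx2] y1b /andP[yby yy2] a.
have Ix : x1 < x < x2 by rewrite xx2 (lt_trans x1b).
have Iy : y1 < y < y2 by rewrite yy2 (lt_trans y1b).
have Iyb : y1 < yb < y2 by rewrite y1b (lt_trans yby).
have cq x' : x1 < x' < x2 -> forall t, y1 < t < y2 -> {for t, continuous (q x')}.
  by move=> Ix' t It; have [] := H _ _ Ix' It.
have It t : t \in `[yb, y] -> y1 < t < y2.
  by rewrite in_itv /= => /andP[bt ty]; rewrite (lt_le_trans y1b bt) (le_lt_trans ty yy2).
have d1E x' t : x1 < x' < x2 -> t \in `[yb, y] -> partial1of2 q x' t = d x' t.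
  by move=> Ix' /It It'; rewrite partial1of2E; have [_ [_ ->]] := H _ _ Ix' It'.
split; last first.
  rewrite -[q x y]add0r; apply: is_deriveD.
  by apply: (is_derive_Rintegral (cq x Ix) y1b); rewrite yby.
have -> : p x y = p x yb + (p x y - p x yb) by rewrite addrC subrK.
apply: is_deriveD.
  apply: (@is_derive_Rintegral (p ^~ yb) x1 x2) => //; last by rewrite xbx.
  by move=> s Is; have [] := H _ _ Is Iyb.
have C0 : 0 <= C by have [_ _ _ _ [_ /(le_trans _)]] := H _ _ Ix Iy; exact.
have mB : measurable `[yb, y] by exact: measurable_itv.
have Ixx : `]x1, x2[%classic x by rewrite /= in_itv.
have intf x' : `]x1, x2[%classic x' -> mu.-integrable `[yb, y] (EFin \o q x').
  rewrite /= in_itv /= => Ix'.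
  by have [_] := continuous_oo_integrable (cq x' Ix') y1b yy2.
have der x' t : `]x1, x2[%classic x' -> `[yb, y]%classic t ->
    derivable (q ^~ t) x' 1.
  by rewrite /= in_itv /= => Ix' /It It'; have [_ []] := H _ _ Ix' It'.
have intG : mu.-integrable `[yb, y] (EFin \o (cst C : R -> R)).
  have cC (s : R) : y1 < s < y2 -> {for s, continuous (cst C : R -> R)}.
    by move=> _; exact: cvg_cst.
  by have [_] := continuous_oo_integrable cC y1b yy2.
have Gub x' t : `]x1, x2[%classic x' -> `[yb, y]%classic t ->
    `|partial1of2 q x' t| <= (cst C : R -> R) t.
  rewrite /= in_itv /= => Ix' Bt; rewrite d1E //.
  by have [_ _ _ _ []] := H _ _ Ix' (It _ Bt).
have D := derivable_under_integral (mu := mu) (f := q) mB Ixx intf der (fun=> C0) intG Gub.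
have E := differentiation_under_integral (mu := mu) (f := q) mB Ixx intf der (fun=> C0) intG Gub.
apply: (DeriveDef D); rewrite -derive1E E.
have cd s : y1 < s < y2 -> {for s, continuous (d x)}.
  by move=> Is; have [_ _ _ _ []] := H _ _ Ix Is.
have pd s : y1 < s < y2 -> is_derive s 1 (p x) (d x s).
  by move=> Is; have [] := H _ _ Ix Is.
rewrite -(Rintegral_derive cd pd y1b) ?yby //.
by apply: eq_Rintegral => t; rewrite inE => Bt; exact: d1E.
Qed.

Local Notation vec := ('cV[R]_2).
Local Notation pt x y := (x *: delta_mx 0 0 + y *: delta_mx 1 0 : vec).

Lemma is_derive_slice0 (a : R -> R -> R) (u : vec) l :
  is_derive (u 0 0) 1 (a ^~ (u 1 0)) l ->
  is_derive u (delta_mx 0 0) (fun u : vec => a (u 0 0) (u 1 0)) l.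
Proof.
move=> [D E].
have S : (fun h : R => h^-1 *: (((fun u : vec => a (u 0 0) (u 1 0)) \o shift u)
      (h *: delta_mx 0 0) - a (u 0 0) (u 1 0)))
  = (fun h => h^-1 *: (((a ^~ (u 1 0)) \o shift (u 0 0)) (h *: 1) - a (u 0 0) (u 1 0))).
  by apply/funext => h /=; rewrite !mxE /= mulr0 add0r.
have D' : derivable (fun u : vec => a (u 0 0) (u 1 0)) u (delta_mx 0 0).
  by rewrite /derivable S.
by apply: (DeriveDef D'); rewrite /derive S.
Qed.

Lemma is_derive_slice1 (a : R -> R -> R) (u : vec) l :
  is_derive (u 1 0) 1 (a (u 0 0)) l ->
  is_derive u (delta_mx 1 0) (fun u : vec => a (u 0 0) (u 1 0)) l.
Proof.
move=> [D E].
have S : (fun h : R => h^-1 *: (((fun u : vec => a (u 0 0) (u 1 0)) \o shift u)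
      (h *: delta_mx 1 0) - a (u 0 0) (u 1 0)))
  = (fun h => h^-1 *: ((a (u 0 0) \o shift (u 1 0)) (h *: 1) - a (u 0 0) (u 1 0))).
  by apply/funext => h /=; rewrite !mxE /= mulr0 add0r.
have D' : derivable (fun u : vec => a (u 0 0) (u 1 0)) u (delta_mx 1 0).
  by rewrite /derivable S.
by apply: (DeriveDef D'); rewrite /derive S.
Qed.

(** Balls of the sup norm are squares, so the rectangles with a corner at a fixed
    base point stay in the domain; the base point is chosen to the lower left of
    the ball so that all integrals run upwards.  Continuity at u0 bounds the
    partial derivative k, as differentiation under the integral requires. *)
Lemma poincare (w : 'I_2 -> vec -> R) D u0 :
  open D -> D u0 -> (forall i, class_C 1 (w i) D) ->
  (forall u, D u -> 'D_(delta_mx 1 0) (w 0) u = 'D_(delta_mx 0 0) (w 1) u) ->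
  exists r a, [/\ 0 < r, ball u0 r `<=` D, class_C 2 a (ball u0 r)
    & forall u i, ball u0 r u -> 'D_(delta_mx i 0) a u = w i u].
Proof.
move=> oD Du0 Cw cl.
pose k := 'D_(delta_mx 0 0) (w 1).
have ck : class_C 0 k D := class_C_derive _ (Cw 1).
have : \forall u \near u0, D u /\ `|k u - k u0| <= 1.
  near=> u; split; near: u; first exact: open_nbhs_nbhs.
  exact: continuous_near (ck _ Du0) ltr01.
move=> /nbhs_ballP[rho /= rho0 br].
have low (c : R) : c - rho < c - rho / 2 by lra.
pose c0 := u0 0 0; pose c1 := u0 1 0.
have bpt (x y : R) : c0 - rho < x < c0 + rho -> c1 - rho < y < c1 + rho -> ball u0 rho (pt x y).
  move=> /andP[x1 x2] /andP[y1 y2]; apply/ball_cV2 => //.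
  rewrite !mxE /= !(mulr0, mulr1, addr0, add0r) !ltr_norml.
  by split; apply/andP; rewrite /c0 /c1 in x1 x2 y1 y2 *; split; lra.
pose p x y := w 0 (pt x y); pose q x y := w 1 (pt x y).
pose d x y := k (pt x y).
pose C := `|k u0| + 1.
pose a x y := \int[mu]_(s in `[c0 - rho / 2, x]) p s (c1 - rho / 2)
            + \int[mu]_(t in `[c1 - rho / 2, y]) q x t.
have dw i z v : D z -> derivable (w i) z v.
  by move=> Dz; apply/diff_derivable/(class_C_differentiable (Cw i)).
have H (x y : R) : c0 - rho < x < c0 + rho -> c1 - rho < y < c1 + rho ->
    [/\ is_derive y 1 (p x) (d x y), is_derive x 1 (q ^~ y) (d x y),
        {for x, continuous (p ^~ y)}, {for y, continuous (q x)} &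
        {for y, continuous (d x)} /\ `|d x y| <= C].
  move=> Ix Iy; have [Dz kz] := br _ (bpt _ _ Ix Iy).
  have qE : q ^~ y = fun x => w 1 (y *: delta_mx 1 0 + x *: delta_mx 0 0).
    by apply/funext => x'; rewrite /q addrC.
  have cx : {for x, continuous (fun x : R => pt x y)}.
    have -> : (fun x : R => pt x y) = (fun x => y *: delta_mx 1 0 + x *: delta_mx 0 0).
      by apply/funext => x'; rewrite addrC.
    exact: continuous_line.
  have cy : {for y, continuous (fun y : R => pt x y)} by exact: continuous_line.
  have cw i : {for pt x y, continuous (w i)}.
    exact/differentiable_continuous/(class_C_differentiable (Cw i)).
  split.
  - by rewrite /d /k -cl //; apply: is_derive_line; exact: dw.
  - rewrite qE /d addrC; apply: is_derive_line; apply: dw; by rewrite addrC.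
  - exact: (@continuous_comp _ _ _ (fun x : R => pt x y) (w 0)).
  - exact: (@continuous_comp _ _ _ (fun y : R => pt x y) (w 1)).
  - split; first by apply: (@continuous_comp _ _ _ (fun y : R => pt x y) k) => //; exact: ck.
    by rewrite /C addrC -lerBlDr (le_trans (lerB_dist _ _)).
pose r := rho / 2; have r0 : 0 < r by rewrite divr_gt0.
have brr u : ball u0 r u -> [/\ c0 - rho / 2 < u 0 0 < c0 + rho,
    c1 - rho / 2 < u 1 0 < c1 + rho & D u].
  move=> bu; have /(ball_cV2 _ _ r0)[] := bu; rewrite !ltr_norml -/c0 -/c1.
  move=> /andP[A1 A2] /andP[B1 B2]; split; rewrite /r in A1 A2 B1 B2.
  - by apply/andP; split; lra.
  - by apply/andP; split; lra.
  - have /br[] // : ball u0 rho u by apply: le_ball bu; rewrite /r; lra.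
have da u i : ball u0 r u -> is_derive u (delta_mx i 0) (fun u : vec => a (u 0 0) (u 1 0)) (w i u).
  move=> /brr[I0 I1 _].
  have [A0 A1] := rectangle_primitive H (low c0) I0 (low c1) I1.
  move: i; apply: I2P.
    by apply: is_derive_slice0; rewrite [in w 0 u](cV2_eta u).
  by apply: is_derive_slice1; rewrite [in w 1 u](cV2_eta u).
exists r, (fun u => a (u 0 0) (u 1 0)).
have bD : ball u0 r `<=` D by move=> u /brr[].
have Cwb i : class_C 1 (w i) (ball u0 r) := class_C_subset bD (Cw i).
have ob : open (ball u0 r) by exact: ball_open.
have df := differentiable_partials ob da (fun i => class_CS (Cwb i)).
split=> //; last by move=> u i /(da u i)[].
split=> // v.
have Cs i := class_CM ob (class_C_cst (W := R) 1 (v i 0) _) (Cwb i).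
apply: class_C_eq ob _ (class_C_sum ob Cs) => u bu.
rewrite derive_cV; last exact: df.
by apply: eq_bigr => i _; have [_ ->] := da u i bu.
Unshelve. all: by end_near. Qed.

End Poincare.

(** * Vectors, rotations and polar decompositions in space *)

Section Tensors3.
Context {R : realType}.
Local Notation V3 := ('cV[R]_3).
Implicit Types (a b n u v w : V3) (c x y : R).

Lemma I3P (P : 'I_3 -> Prop) : P 0 -> P 1 -> P 2 -> forall i, P i.
Proof.
move=> P0 P1 P2 [[|[|[|//]]] i3].
- by rewrite (_ : Ordinal i3 = 0) //; exact/val_inj.
- by rewrite (_ : Ordinal i3 = 1) //; exact/val_inj.
- by rewrite (_ : Ordinal i3 = 2) //; exact/val_inj.
Qed.

Lemma sum3 (W : nmodType) (f : 'I_3 -> W) : \sum_i f i = f 0 + f 1 + f 2.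
Proof.
rewrite !big_ord_recl big_ord0 addr0 addrA.
by congr (_ + f _ + f _); exact/val_inj.
Qed.

Let I3_arith : let eq (i j k : 'I_3) := i + j = k in
  (eq 0 1 1 * eq 0 2 2 * eq 1 1 2 * eq 1 2 0 * eq 2 1 0 * eq 2 2 1)%type.
Proof. by do !split; exact/val_inj. Qed.

Lemma dotE u v : dot u v = u 0 0 * v 0 0 + u 1 0 * v 1 0 + u 2 0 * v 2 0.
Proof. by rewrite /dot sum3. Qed.

Lemma crossE u v : let eq (x y : R) := x = y in
  (eq (cross u v 0 0) (u 1 0 * v 2 0 - u 2 0 * v 1 0) *
   eq (cross u v 1 0) (u 2 0 * v 0 0 - u 0 0 * v 2 0) *
   eq (cross u v 2 0) (u 0 0 * v 1 0 - u 1 0 * v 0 0))%type.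
Proof. by do !split; rewrite /cross mxE !I3_arith. Qed.

Lemma mulmx3 m p (A : 'M[R]_(m, 3)) (B : 'M[R]_(3, p)) i j :
  (A *m B) i j = A i 0 * B 0 j + A i 1 * B 1 j + A i 2 * B 2 j.
Proof. by rewrite mxE sum3. Qed.

Lemma mulmx_tr d (M : 'cV[R]_d) i j : (M *m M^T) i j = M i 0 * M j 0.
Proof. by rewrite mxE big_ord1 mxE. Qed.

Lemma skewE n : skew_tensor n = \matrix_(i, j)
  (if (j == i + 1) then - n (i + 2) 0 else if (j == i + 2) then n (i + 1) 0 else 0).
Proof.
apply/matrixP; apply: I3P; apply: I3P; by rewrite !mxE !I3_arith /= !mulr_natr ?(mulr1n, mulr0n, subr0, sub0r, subrr).
Qed.

(* mxE comes last: it would unfold the products that the other rules evaluate *)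
Ltac coords := do ?rewrite !(dotE, crossE, mulmx_tr, mulmx3, I3_arith, mxE) /=.
Ltac vec3 := apply/colP; apply: I3P; coords.

Lemma dotC u v : dot u v = dot v u. Proof. by coords; ring. Qed.
Lemma dotDr u v w : dot u (v + w) = dot u v + dot u w. Proof. by coords; ring. Qed.
Lemma dotZr x u v : dot u (x *: v) = x * dot u v. Proof. by coords; ring. Qed.
Lemma dot0r u : dot u 0 = 0. Proof. by coords; ring. Qed.
Lemma crossDr u v w : cross u (v + w) = cross u v + cross u w.
Proof. by vec3; ring. Qed.
Lemma crossZr x u v : cross u (x *: v) = x *: cross u v.
Proof. by vec3; ring. Qed.
Lemma dot_crossl u v : dot u (cross u v) = 0. Proof. by coords; ring. Qed.

Lemma cross_cross u v w : cross u (cross v w) = dot u w *: v - dot u v *: w.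
Proof. by vec3; ring. Qed.

Lemma dot_mulmx (M : 'M[R]_3) u v : dot u (M *m v) = dot (M^T *m u) v.
Proof. by coords; ring. Qed.

Lemma dot_gt0 v : v != 0 -> 0 < dot v v.
Proof.
move=> v0; rewrite lt_def dotE; apply/andP; split; last first.
  by rewrite !addr_ge0 // -expr2 sqr_ge0.
apply: contra v0; rewrite -!expr2 !paddr_eq0 ?addr_ge0 ?sqr_ge0 //.
rewrite !sqrf_eq0 => /andP[/andP[/eqP v0 /eqP v1] /eqP v2].
by apply/eqP; vec3.
Qed.

(** The trace is the derivative of the determinant at the identity, and
    dot n (cross a b) is the determinant with columns a, b, n. *)
Lemma tr_cross (G : 'M[R]_3) a b n : \tr G * dot n (cross a b) =
  dot n (cross (G *m a) b + cross a (G *m b)) + dot (G *m n) (cross a b).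
Proof. by rewrite /mxtrace sum3; coords; ring. Qed.

Lemma det3_frame a b n v : dot n (cross a b) *: v =
  dot v (cross b n) *: a + dot v (cross n a) *: b + dot v (cross a b) *: n.
Proof. by vec3; ring. Qed.

Lemma det3_coframe a b n v : dot n (cross a b) *: v =
  dot v a *: cross b n + dot v b *: cross n a + dot v n *: cross a b.
Proof. by vec3; ring. Qed.

(** Expanding n x (n x (a x b)) in two ways, since n x (a x b) = 0. *)
Lemma cross_normal n a b : dot n n = 1 -> dot n a = 0 -> dot n b = 0 ->
  cross a b = dot n (cross a b) *: n.
Proof.
move=> nn na nb; have := cross_cross n n (cross a b).
rewrite nn scale1r (cross_cross n a b) na nb !scale0r subrr.
have -> : cross n 0 = 0 by vec3; ring.
by move/esym/eqP; rewrite subr_eq0 => /eqP.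
Qed.

Lemma tanprojE n v : tanproj n *m v = v - dot n v *: n.
Proof. by vec3; rewrite ?mulr0n ?mulr1n; ring. Qed.

Lemma tanproj_id n v : dot n v = 0 -> tanproj n *m v = v.
Proof. by move=> nv; rewrite tanprojE nv scale0r subr0. Qed.

Lemma tanproj_normal n : dot n n = 1 -> tanproj n *m n = 0.
Proof. by move=> nn; rewrite tanprojE nn scale1r subrr. Qed.

Lemma tanproj_tr n : (tanproj n)^T = tanproj n.
Proof. by rewrite linearB /= trmx1 trmx_mul trmxK. Qed.

Lemma dot_tanproj n v : dot n n = 1 -> dot n (tanproj n *m v) = 0.
Proof. by move=> nn; rewrite dot_mulmx tanproj_tr tanproj_normal // dotC dot0r. Qed.

Lemma skew_mulmx n v : skew_tensor n *m v = cross n v.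
Proof. by rewrite skewE; vec3; ring. Qed.

Lemma rotmx_mulmx n x v : rotmx n x *m v =
  v + sin x *: cross n v - (1 - cos x) *: (tanproj n *m v).
Proof.
by rewrite /rotmx 2!mulmxDl mulNmx -!scalemxAl mul1mx skew_mulmx.
Qed.

Lemma rotmx_normal n x : dot n n = 1 -> rotmx n x *m n = n.
Proof.
move=> nn; rewrite rotmx_mulmx tanproj_normal // scaler0 subr0.
have -> : cross n n = 0 by vec3; ring.
by rewrite scaler0 addr0.
Qed.

Lemma rotmx_tangent n x v : dot n v = 0 ->
  rotmx n x *m v = cos x *: v + sin x *: cross n v.
Proof. by move=> nv; rewrite rotmx_mulmx tanproj_id //; vec3; ring. Qed.

Lemma det3 (M : 'M[R]_3) : \det M =
  M 0 0 * (M 1 1 * M 2 2 - M 1 2 * M 2 1) - M 0 1 * (M 1 0 * M 2 2 - M 1 2 * M 2 0)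
  + M 0 2 * (M 1 0 * M 2 1 - M 1 1 * M 2 0).
Proof.
pose f (i j : nat) : R := M (inord i) (inord j).
have Mf i j : M i j = f i j by rewrite /f !inord_val.
rewrite (expand_det_row _ ord0) !big_ord_recl big_ord0 /cofactor.
rewrite !(expand_det_row _ ord0) !big_ord_recl !big_ord0 /cofactor !det_mx11 !mxE.
rewrite !Mf /= /bump /= !(expr0, expr1, exprS).
ring.
Qed.

Lemma mulmx_ext m d (A B : 'M[R]_(m, d)) :
  (forall v : 'cV[R]_d, A *m v = B *m v) -> A = B.
Proof.
move=> AB; apply/matrixP => i j.
have := congr1 (fun v : 'cV[R]_m => v i 0) (AB (delta_mx j 0)).
by rewrite -!colE !mxE.
Qed.

Lemma rotmxE n x v :
  rotmx n x *m v = cos x *: v + sin x *: cross n v + ((1 - cos x) * dot n v) *: n.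
Proof. by rewrite rotmx_mulmx tanprojE; vec3; ring. Qed.

Lemma rotmx_tr n x : (rotmx n x)^T = rotmx n (- x).
Proof.
rewrite /rotmx sinN cosN skewE.
by apply/matrixP; apply: I3P; apply: I3P; coords; ring.
Qed.

Lemma rotmx_rotation n x : dot n n = 1 -> is_rotation (rotmx n x).
Proof.
move=> nn; have cs : cos x ^+ 2 + sin x ^+ 2 = 1 := cos2Dsin2 x.
split.
  apply: mulmx_ext => v; rewrite mul1mx -mulmxA rotmx_tr !rotmxE sinN cosN.
  rewrite !(crossDr, crossZr, dotDr, dotZr) nn dot_crossl cross_cross nn.
  have -> : cross n n = 0 by vec3; ring.
  set c := cos x in cs *; set s := sin x in cs *; set p := dot n v.
  set m := cross n v; apply/colP => i; rewrite !mxE.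
  apply/eqP; rewrite -subr_eq0; apply/eqP.
  transitivity ((c ^+ 2 + s ^+ 2 - 1) * (v i 0 - p * n i 0)); first by ring.
  by rewrite cs subrr mul0r.
have -> : \det (rotmx n x) =
    (cos x + (1 - cos x) * dot n n) * (cos x ^+ 2 + sin x ^+ 2 * dot n n).
  by rewrite det3 /rotmx skewE; coords; rewrite ?(mulr1n, mulr0n); ring.
by rewrite nn !mulr1 cs addrC subrK mulr1.
Qed.

(** A rotation is its own cofactor matrix. *)
Lemma rotation_cross (Q : 'M[R]_3) a b : is_rotation Q ->
  Q *m cross a b = cross (Q *m a) (Q *m b).
Proof.
move=> [QQ dQ].
have E : Q^T *m cross (Q *m a) (Q *m b) = \det Q *: cross a b.
  by rewrite det3; vec3; ring.
by rewrite -[RHS]mul1mx -(mulmx1C QQ) -mulmxA E dQ scale1r.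
Qed.

Lemma polar_conformal n c (Q : 'M[R]_3) : dot n n = 1 -> 0 < c -> is_rotation Q ->
  polar n (c *: (Q *m tanproj n)) Q (c *: tanproj n).
Proof.
move=> nn c0 rQ; split=> //.
- by rewrite linearZ /= tanproj_tr -scalemxAl tanproj_normal // scaler0.
- by move=> v _; rewrite -scalemxAl dotZr dot_tanproj // mulr0.
- move=> v nv v0; rewrite -scalemxAl tanproj_id // dotZr.
  by rewrite mulr_gt0 // dot_gt0.
- by rewrite scalemxAr.
Qed.

(** The stretch squares to c^2 on the tangent plane and is positive there, so it
    is c; both rotations then agree on the tangent plane, hence on the normal. *)
Lemma polar_conformal_normal n c (Q0 Q U : 'M[R]_3) a b :
  dot n n = 1 -> 0 < c -> is_rotation Q0 -> Q0 *m n = n ->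
  dot n a = 0 -> dot n b = 0 -> dot n (cross a b) != 0 ->
  polar n (c *: (Q0 *m tanproj n)) Q U -> Q *m n = n.
Proof.
move=> nn c0 [QQ0 dQ0] Q0n na nb nab [[QQ dQ] [Us Un] Utan Upos GQU].
have UU v : dot n v = 0 -> U *m (U *m v) = c ^+ 2 *: v.
  move=> nv; have : (Q *m U)^T *m (Q *m U *m v) = U *m (U *m v).
    by rewrite trmx_mul Us -2!mulmxA (mulmxA Q^T) QQ mul1mx.
  have GT : (c *: (Q0 *m tanproj n))^T = c *: (tanproj n *m Q0^T).
    by rewrite linearZ /= trmx_mul tanproj_tr.
  rewrite -GQU GT -!scalemxAl -!mulmxA (tanproj_id nv) -!scalemxAr (mulmxA Q0^T) QQ0.
  by rewrite mul1mx (tanproj_id nv) scalerA -expr2 => <-.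
have Uc v : dot n v = 0 -> U *m v = c *: v.
  move=> nv; apply/eqP; rewrite -subr_eq0; apply: contraT => w0.
  set w := _ - _ in w0.
  have nw : dot n w = 0.
    by rewrite /w -scaleNr dotDr dotZr nv mulr0 addr0 Utan.
  have Uw : U *m w = (- c) *: w.
    rewrite /w mulmxBr UU // -scalemxAr; vec3; ring.
  have := Upos w nw w0; rewrite Uw dotZr mulNr oppr_gt0.
  by rewrite pmulr_rlt0 // => /lt_trans/(_ (dot_gt0 w0)); rewrite ltxx.
have QQ0v v : dot n v = 0 -> Q *m v = Q0 *m v.
  move=> nv; apply: (@scalerI _ _ c); first by rewrite gt_eqF.
  rewrite !scalemxAr -[in LHS]Uc // mulmxA -GQU -scalemxAl -mulmxA tanproj_id //.
  by rewrite scalemxAr.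
have : Q *m cross a b = Q0 *m cross a b.
  by rewrite !rotation_cross // !QQ0v.
rewrite (cross_normal nn na nb) -!scalemxAr Q0n.
exact: scalerI.
Qed.

Lemma eq_mulmx_frame (G G' : 'M[R]_3) n a b : dot n (cross a b) != 0 ->
  G *m n = G' *m n -> G *m a = G' *m a -> G *m b = G' *m b -> G = G'.
Proof.
move=> d0 En Ea Eb; apply: mulmx_ext => v; apply: (scalerI d0).
by rewrite -!linearZ /= det3_frame !linearD !linearZ /= En Ea Eb.
Qed.

Lemma eq_dot_frame n a b v w : dot n (cross a b) != 0 ->
  dot v n = dot w n -> dot v a = dot w a -> dot v b = dot w b -> v = w.
Proof.
by move=> d0 En Ea Eb; apply: (scalerI d0); rewrite !det3_coframe En Ea Eb.
Qed.

(** If a and b were dependent, so would be their images under M, the two basis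
    vectors of the plane. *)
Lemma frame_neq0 n a b (M : 'M[R]_(2, 3)) : dot n n = 1 -> dot n a = 0 -> dot n b = 0 ->
  M *m a = delta_mx 0 0 -> M *m b = delta_mx 1 0 -> dot n (cross a b) != 0.
Proof.
move=> nn na nb Ma Mb; apply/eqP => nab.
have cab : cross a b = 0 by rewrite (cross_normal nn na nb) nab scale0r.
have E := cross_cross a a b.
have := congr1 (fun v => (M *m v) 1 0) E; rewrite /= cab.
have -> : cross a 0 = 0 by vec3; ring.
rewrite mulmx0 mulmxBr -!scalemxAr Ma Mb !mxE /= mulr0 mulr1 sub0r => /eqP.
rewrite eq_sym oppr_eq0 => /eqP aa.
have a0 : a = 0.
  by apply/eqP; apply: contraT => /dot_gt0; rewrite aa ltxx.
have := congr1 (fun v : 'cV[R]_2 => v 0 0) Ma.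
by rewrite a0 mulmx0 !mxE /= => /eqP; rewrite eq_sym oner_eq0.
Qed.

(** * Identities in the frame of a minimal surface *)

(** At a point of a parametrised surface, X1 and X2 stand for the derivatives of
    the parametrisation, N1 and N2 for those of the normal n, and g, g1, g2 for a
    tangential gradient and its derivatives; min says that the surface is minimal. *)
Section Frame.
Variables (n X1 X2 N1 N2 g g1 g2 : V3).
Hypotheses (nn : dot n n = 1) (nX1 : dot n X1 = 0) (nX2 : dot n X2 = 0).
Hypotheses (nN1 : dot n N1 = 0) (nN2 : dot n N2 = 0) (ng : dot n g = 0).
Hypothesis min : dot n (cross N1 X2 + cross X1 N2) = 0.

(** All four vectors are tangent, so this sum is a multiple of n. *)
Lemma minimal_cross : cross N1 X2 + cross X1 N2 = 0.
Proof.
rewrite (cross_normal nn nN1 nX2) (cross_normal nn nX1 nN2) -scalerDl -dotDr.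
by rewrite min scale0r.
Qed.

(** The difference of both sides combines the two divergences, those of the
    normal and of the gradient. *)
Lemma conjugate_closed : dot n (cross g1 X2 + cross X1 g2) = 0 ->
  dot (cross N2 g + cross n g2) X1 = dot (cross N1 g + cross n g1) X2.
Proof.
move=> har; apply/eqP; rewrite -subr_eq0; apply/eqP.
transitivity (dot g (cross N1 X2 + cross X1 N2) - dot n (cross g1 X2 + cross X1 g2)).
  by coords; ring.
by rewrite har minimal_cross dot0r subr0.
Qed.

(** Here dot X1 g2 = dot X2 g1 is the symmetry of the Hessian. *)
Lemma conjugate_harmonic : dot X1 g2 = dot X2 g1 ->
  dot n (cross (cross N1 g + cross n g1) X2 + cross X1 (cross N2 g + cross n g2)) = 0.
Proof.
move=> sym.
transitivity (dot n g * dot N1 X2 - dot n N1 * dot g X2 + dot n g1 * dot n X2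
  - dot n n * dot X2 g1 + dot n N2 * dot X1 g - dot n g * dot X1 N2
  + dot n n * dot X1 g2 - dot n g2 * dot n X1); first by coords; ring.
by rewrite ng nN1 nN2 nX1 nX2 nn sym; ring.
Qed.

(** The differentials of phi and of its conjugate are g and n x g.  Since
    (g.X2) X1 - (g.X1) X2 = g x (X1 x X2) is a multiple of g x n, and likewise for
    n x g, a right angle about n exchanges the two contributions. *)
Lemma gradient_turn :
  dot g X2 *: X1 - dot g X1 *: X2 + dot (cross n g) X2 *: cross n X1
    - dot (cross n g) X1 *: cross n X2 = 0 /\
  dot g X2 *: cross n X1 - dot g X1 *: cross n X2
    - (dot (cross n g) X2 *: X1 - dot (cross n g) X1 *: X2) = 0.
Proof.
have c12 := cross_normal nn nX1 nX2; set l := dot n _ in c12.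
have gn : cross (cross n g) n = g.
  transitivity (dot n n *: g - dot n g *: n); first by vec3; ring.
  by rewrite nn ng scale0r subr0 scale1r.
have A : dot g X2 *: X1 - dot g X1 *: X2 = l *: cross g n.
  by rewrite -cross_cross c12 crossZr.
have B : dot (cross n g) X2 *: X1 - dot (cross n g) X1 *: X2 = l *: g.
  by rewrite -cross_cross c12 crossZr gn.
split.
  transitivity (dot g X2 *: X1 - dot g X1 *: X2 +
    cross n (dot (cross n g) X2 *: X1 - dot (cross n g) X1 *: X2)).
    by vec3; ring.
  by rewrite A B; vec3; ring.
transitivity (cross n (dot g X2 *: X1 - dot g X1 *: X2) -
    (dot (cross n g) X2 *: X1 - dot (cross n g) X1 *: X2)).
  by vec3; ring.
rewrite A B -[in X in _ - X]gn; vec3; ring.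
Qed.

(** Closedness of the form whose coefficients are e (c X_i + s n x X_i), where e, c
    and s are exp phi, cos alpha and sin alpha: the derivatives of phi and alpha
    cancel by the preceding lemma, and the derivatives of n by minimality. *)
Lemma deformation_closed (X12 X21 : V3) (e c s p1 p2 a1 a2 : R) :
  p1 = dot g X1 -> p2 = dot g X2 ->
  a1 = dot (cross n g) X1 -> a2 = dot (cross n g) X2 -> X12 = X21 ->
  e *: (p2 *: (c *: X1 + s *: cross n X1) +
    ((- s * a2) *: X1 + c *: X12 + ((c * a2) *: cross n X1
      + s *: (cross N2 X1 + cross n X12))))
  = e *: (p1 *: (c *: X2 + s *: cross n X2) +
    ((- s * a1) *: X2 + c *: X21 + ((c * a1) *: cross n X2
      + s *: (cross N1 X2 + cross n X21)))).
Proof.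
move=> p1E p2E a1E a2E ->; congr (_ *: _); rewrite p1E p2E {p1 p2 p1E p2E}.
apply/eqP; rewrite -subr_eq0; apply/eqP.
have [E1 E2] := gradient_turn; rewrite -a1E -a2E in E1 E2.
transitivity (c *: (dot g X2 *: X1 - dot g X1 *: X2 + a2 *: cross n X1 - a1 *: cross n X2)
  + s *: (dot g X2 *: cross n X1 - dot g X1 *: cross n X2 - (a2 *: X1 - a1 *: X2))
  - s *: (cross N1 X2 + cross X1 N2)).
  move: (dot g X1) (dot g X2) => p1 p2.
  by vec3; ring.
by rewrite E1 E2 minimal_cross !scaler0 addr0 subr0.
Qed.

(** The rotation by alpha mixes the mean curvature with the antisymmetric part of
    the curvature tensor, and both vanish. *)
Lemma rotated_minimal (c s e : R) : dot N1 X2 = dot N2 X1 ->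
  dot n (cross N1 (e *: (c *: X2 + s *: cross n X2))
    + cross (e *: (c *: X1 + s *: cross n X1)) N2) = 0.
Proof.
move=> sym.
transitivity (e * (c * dot n (cross N1 X2 + cross X1 N2)
  + s * (dot n n * (dot N1 X2 - dot N2 X1) - dot n N1 * dot n X2
       + dot n X1 * dot n N2))); first by coords; ring.
by rewrite min sym subrr nN1 nX1; ring.
Qed.

End Frame.
End Tensors3.

(** * Fields on a surface read in charts *)

Section Fields.
Context {R : realType}.
Local Notation V2 := ('cV[R]_2).
Local Notation V3 := ('cV[R]_3).
Implicit Types V W : normedModType R.

Lemma class_C_local V W k (f : V -> W) U :
  (forall x, U x -> exists U', [/\ open U', U' x & class_C k f U']) -> class_C k f U.
Proof.
elim: k f => [|k IH] f H /=.
  by move=> x /H[U' [_ Ux' cf]]; exact: cf.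
split=> [x /H[U' [_ Ux' [df _]]]|v]; first exact: df.
apply: IH => x /H[U' [oU' Ux' Cf]]; exists U'; split=> //.
exact: class_C_derive.
Qed.

Lemma open_setI_preimage (T T' : topologicalType) (f : T -> T') D A :
  open D -> (forall x, D x -> {for x, continuous f}) -> open A ->
  open (D `&` f @^-1` A).
Proof.
move=> oD cf oA; rewrite openE => x [Dx Ax]; apply: filterI.
  exact: open_nbhs_nbhs.
by apply: (cf x Dx); exact: open_nbhs_nbhs.
Qed.

Lemma class_C_continuous V W k (f : V -> W) U x :
  class_C k f U -> U x -> {for x, continuous f}.
Proof. by move=> Cf Ux; have /(_ x Ux) := class_C_le (leq0n k) Cf. Qed.

Lemma is_derive_mx V m n (f : V -> 'M[R]_(m, n)) x v (d : 'M[R]_(m, n)) :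
  (forall i j, is_derive x v (fun y => f y i j) (d i j)) -> is_derive x v f d.
Proof.
move=> H; have D : derivable f x v by apply/derivable_mxP => i j; have [] := H i j.
apply: (DeriveDef D); rewrite derive_mx //; apply/matrixP => i j.
by rewrite mxE; have [_ ->] := H i j.
Qed.

Lemma is_derive_prod V (f g : V -> R) x v df dg :
  is_derive x v f df -> is_derive x v g dg ->
  is_derive x v (fun y => f y * g y) (df * g x + f x * dg).
Proof.
move=> Df Dg; apply: is_derive_eq (is_deriveM Df Dg) _.
by rewrite addrC /GRing.scale /= mulrC.
Qed.

Lemma is_derive_dot V (f g : V -> V3) x v df dg :
  is_derive x v f df -> is_derive x v g dg ->
  is_derive x v (fun y => dot (f y) (g y)) (dot df (g x) + dot (f x) dg).
Proof.
move=> Df Dg; have P i := is_derive_prod (is_derive_coord i 0 Df) (is_derive_coord i 0 Dg).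
have -> : (fun y => dot (f y) (g y)) =
    (fun y => f y 0 0 * g y 0 0) + (fun y => f y 1 0 * g y 1 0)
    + (fun y => f y 2 0 * g y 2 0).
  by apply/funext => y; rewrite dotE.
apply: is_derive_eq (is_deriveD (is_deriveD (P 0) (P 1)) (P 2)) _.
by rewrite !dotE; ring.
Qed.

Lemma is_derive_cross V (f g : V -> V3) x v df dg :
  is_derive x v f df -> is_derive x v g dg ->
  is_derive x v (fun y => cross (f y) (g y)) (cross df (g x) + cross (f x) dg).
Proof.
move=> Df Dg.
have P i j := is_derive_prod (is_derive_coord i 0 Df) (is_derive_coord j 0 Dg).
apply: is_derive_mx => i j; rewrite (ord1 j).
have -> : (fun y => cross (f y) (g y) i 0) =
    (fun y => f y (i + 1) 0 * g y (i + 2) 0) - (fun y => f y (i + 2) 0 * g y (i + 1) 0).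
  by apply/funext => y; rewrite mxE.
apply: is_derive_eq (is_deriveB (P _ _) (P _ _)) _.
by rewrite !mxE; ring.
Qed.

Lemma is_derive_scale V n (a : V -> R) (f : V -> 'cV[R]_n) x v da df :
  is_derive x v a da -> is_derive x v f df ->
  is_derive x v (fun y => a y *: f y) (da *: f x + a x *: df).
Proof.
move=> Da Df; apply: is_derive_mx => i j.
have -> : (fun y => (a y *: f y) i j) = (fun y => a y * f y i j).
  by apply/funext => y; rewrite mxE.
by apply: is_derive_eq (is_derive_prod Da (is_derive_coord i j Df)) _; rewrite !mxE.
Qed.

Lemma class_C_scale V m n k (a : V -> R) (f : V -> 'M[R]_(m, n)) U : open U ->
  class_C k a U -> class_C k f U -> class_C k (fun x => a x *: f x) U.
Proof.
move=> oU Ca Cf; apply: class_C_mx => // i j.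
by apply: class_C_eq oU _ (class_CM oU Ca (class_C_coord i j oU Cf)) => x _; rewrite mxE.
Qed.

Lemma class_C_dot V k (f g : V -> V3) U : open U ->
  class_C k f U -> class_C k g U -> class_C k (fun x => dot (f x) (g x)) U.
Proof.
move=> oU Cf Cg; apply: class_C_sum => // i.
by apply: class_CM => //; exact: class_C_coord.
Qed.

Lemma class_C_cross V k (f g : V -> V3) U : open U ->
  class_C k f U -> class_C k g U -> class_C k (fun x => cross (f x) (g x)) U.
Proof.
move=> oU Cf Cg; apply: class_C_mx => // i j.
have P i j := class_CM oU (class_C_coord i 0 oU Cf) (class_C_coord j 0 oU Cg).
apply: class_C_eq oU _ (class_CD oU (P (i + 1) (i + 2)) (class_CN oU (P (i + 2) (i + 1)))).
by move=> x _; rewrite (ord1 j) mxE.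
Qed.

Lemma class_C_tr V m n k (f : V -> 'M[R]_(m, n)) U : open U ->
  class_C k f U -> class_C k (fun x => (f x)^T) U.
Proof.
move=> oU Cf; apply: class_C_mx => // i j.
by apply: class_C_eq oU _ (class_C_coord j i oU Cf) => x _; rewrite mxE.
Qed.

Lemma class_C_tanproj V k (f : V -> V3) U : open U ->
  class_C k f U -> class_C k (fun x => tanproj (f x)) U.
Proof.
move=> oU Cf; apply: class_CD => //; first exact: class_C_cst.
have C := class_C_scale oU (class_C_cst (W := R) k (-1) U)
  (class_C_mulmx oU Cf (class_C_tr oU Cf)).
by apply: class_C_eq oU _ C => x _; rewrite scaleN1r.
Qed.

Section Charts.
Variables (S : set V3) (D : set V2) (V : set V3) (X : V2 -> V3) (Z : V3 -> V2).
Hypothesis cX : chart S D V X Z.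

Lemma chart_openD : open D. Proof. by case: cX => -[]. Qed.
Lemma chart_openV : open V. Proof. by case: cX => -[]. Qed.
Lemma chart_C2 : class_C 2 X D. Proof. by case: cX. Qed.
Lemma chart_ZX u : D u -> Z (X u) = u. Proof. by case: cX => _ _ _ + _; exact. Qed.

Lemma chart_in u : D u -> S (X u) /\ V (X u).
Proof.
by case: cX => _ _ _ _ E Du; have : (S `&` V) (X u) by rewrite -E; exists u.
Qed.

Lemma chart_out p : S p -> V p -> exists2 u, D u & X u = p.
Proof. by case: cX => _ _ _ _ E Sp Vp; have : (X @` D) p by rewrite E. Qed.

Lemma chart_dX u : D u -> differentiable X u.
Proof. exact: class_C_differentiable chart_C2. Qed.

Lemma chart_contX u : D u -> {for u, continuous X}.
Proof. exact: class_C_continuous chart_C2. Qed.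

Lemma chart_dZ p : V p -> differentiable Z p.
Proof. by case: cX => _ _ + _ _; exact: class_C_differentiable. Qed.

Lemma chart_contZ p : V p -> {for p, continuous Z}.
Proof. by case: cX => _ _ + _ _; exact: class_C_continuous. Qed.

Lemma chart_jac u v : D u -> jac Z (X u) *m 'D_v X u = v.
Proof.
move=> Du; have [_ VX] := chart_in Du.
rewrite -jacE; last exact: chart_dZ.
rewrite -derive_comp; [|exact: chart_dX|exact: chart_dZ].
rewrite -[RHS](derive_id u v); apply: near_eq_derive.
have : \forall a \near u, D a by exact: open_nbhs_nbhs (conj chart_openD Du).
by apply: filterS => a Da; exact: chart_ZX.
Qed.

Lemma chart_restrict D0 : open D0 -> D0 `<=` D ->
  chart S D0 (V `&` Z @^-1` D0) X Z /\ S `&` (V `&` Z @^-1` D0) = X @` D0.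
Proof.
move=> oD0 D0D.
have E : S `&` (V `&` Z @^-1` D0) = X @` D0.
  apply/seteqP; split=> [p [Sp [Vp D0p]]|_ [u D0u <-]].
    have [u Du Xu] := chart_out Sp Vp.
    by exists u => //; move: D0p; rewrite /= -Xu chart_ZX.
  have Du := D0D _ D0u; have [SX VX] := chart_in Du.
  by do !split=> //; rewrite /= chart_ZX.
split=> //; case: cX => [[oD oV] CX CZ ZX _]; split=> //.
- by split=> //; exact: open_setI_preimage (oV) chart_contZ oD0.
- exact: class_C_subset CX.
- by apply: class_C_subset CZ => p [].
- by move=> u /D0D; exact: ZX.
Qed.

Lemma chart_setI (V' : set V3) : open V' -> chart (S `&` V') (D `&` X @^-1` V') (V `&` V') X Z.
Proof.
move=> oV'; case: (cX) => [[oD oV] CX CZ ZX E]; split.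
- split; last exact: openI.
  exact: open_setI_preimage oD chart_contX oV'.
- by apply: class_C_subset CX => u [].
- by apply: class_C_subset CZ => p [].
- by move=> u [/ZX].
- apply/seteqP; split=> [_ [u [Du V'u] <-]|p [[Sp V'p] [Vp _]]].
    by have [SX VX] := chart_in Du.
  by have [u Du Xu] := chart_out Sp Vp; exists u => //; split; rewrite //= Xu.
Qed.

(** On the surface X o Z is the identity, so f o X o Z extends f. *)
Lemma extends_pullback W k (f : V3 -> W) u : D u ->
  class_C k (f \o X \o Z) (V `&` Z @^-1` D) -> extends k S f (X u) (f \o X \o Z).
Proof.
move=> Du C; have [SX VX] := chart_in Du; exists (V `&` Z @^-1` D); split=> //.
  split; last by split; rewrite //= chart_ZX.
  exact: open_setI_preimage chart_openV chart_contZ chart_openD.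
by move=> p Sp [Vp _] /=; have [a Da <-] := chart_out Sp Vp; rewrite chart_ZX.
Qed.

Lemma field_of_pullback_mx m n k (f : V3 -> 'M[R]_(m, n)) u : (k <= 2)%N -> D u ->
  class_C k (f \o X) D -> exists F, extends k S f (X u) F.
Proof.
move=> k2 Du C; exists (f \o X \o Z); apply: extends_pullback => //.
have oVD : open (V `&` Z @^-1` D).
  exact: open_setI_preimage chart_openV chart_contZ chart_openD.
apply: (class_C_compmx oVD chart_openD _ _ C) => [p []//|].
apply: (@class_C_subset _ _ _ _ _ _ V) => [p []//|].
by apply: (class_C_le k2); case: cX.
Qed.

Lemma field_of_pullback k (f : V3 -> R) u : (k <= 2)%N -> D u ->
  class_C k (f \o X) D -> exists F, extends k S f (X u) F.
Proof.
move=> k2 Du C; exists (f \o X \o Z); apply: extends_pullback => //.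
have oVD : open (V `&` Z @^-1` D).
  exact: open_setI_preimage chart_openV chart_contZ chart_openD.
apply: (class_C_comp oVD _ _ C) => [p []//|].
apply: (@class_C_subset _ _ _ _ _ _ V) => [p []//|].
by apply: (class_C_le k2); case: cX.
Qed.

Lemma pullback_C_mx m n k (f : V3 -> 'M[R]_(m, n)) : (k <= 2)%N -> field_C k S f ->
  class_C k (f \o X) D.
Proof.
move=> k2 Cf; apply: class_C_local => u Du.
have [SX _] := chart_in Du; have [F [V' [[oV' V'X] CF Ff]]] := Cf _ SX.
exists (D `&` X @^-1` V'); have oU := open_setI_preimage chart_openD chart_contX oV'.
split=> //; apply: (class_C_eq (f := F \o X) oU).
  by move=> a [Da V'a]; apply: Ff => //; case: (chart_in Da).
apply: (class_C_compmx oU oV' _ _ CF) => [a []//|].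
apply: (@class_C_subset _ _ _ _ _ _ D) => [a []//|].
exact: class_C_le k2 chart_C2.
Qed.

Lemma pullback_C k (f : V3 -> R) : (k <= 2)%N -> field_C k S f ->
  class_C k (f \o X) D.
Proof.
move=> k2 Cf; apply: class_C_local => u Du.
have [SX _] := chart_in Du; have [F [V' [[oV' V'X] CF Ff]]] := Cf _ SX.
exists (D `&` X @^-1` V'); have oU := open_setI_preimage chart_openD chart_contX oV'.
split=> //; apply: (class_C_eq (f := F \o X) oU).
  by move=> a [Da V'a]; apply: Ff => //; case: (chart_in Da).
apply: (class_C_comp oU _ _ CF) => [a []//|].
apply: (@class_C_subset _ _ _ _ _ _ D) => [a []//|].
exact: class_C_le k2 chart_C2.
Qed.

Lemma derive_pullback W (f F : V3 -> W) u v : D u -> extends 1 S f (X u) F ->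
  differentiable F (X u) /\ 'D_v (f \o X) u = 'D_('D_v X u) F (X u).
Proof.
move=> Du [V' [[oV' V'X] CF Ff]].
have dF : differentiable F (X u) by exact: class_C_differentiable CF V'X.
split=> //; rewrite -derive_comp //; last exact: chart_dX.
apply: near_eq_derive.
have : \forall a \near u, (D `&` X @^-1` V') a.
  apply: open_nbhs_nbhs; split=> //.
  exact: open_setI_preimage chart_openD chart_contX oV'.
by apply: filterS => a [Da V'a] /=; rewrite Ff //; case: (chart_in Da).
Qed.

End Charts.

(** Two charts differ near a common point by a differentiable change of
    parameters, so either one sees all tangent vectors. *)
Lemma tangent_chart S D (V : set V3) X Z u v : chart S D V X Z -> D u ->
  tangent S (X u) v -> exists h, v = 'D_h X u.
Proof.
move=> cX Du [D' [V' [X' [Z' [u' [h [cX' Du' E ->]]]]]]].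
have [_ VX] := chart_in cX Du.
have dX' := chart_dX cX' Du'.
have dZ : differentiable Z (X' u'). by rewrite E; exact: (chart_dZ cX VX).
have dW : differentiable (Z \o X') u' by exact: differentiable_comp.
exists ('D_h (Z \o X') u').
have WE : (Z \o X') u' = u by rewrite /= E (chart_ZX cX).
have dX : differentiable X ((Z \o X') u') by rewrite WE; exact: (chart_dX cX Du).
have DC := derive_comp h dW dX; rewrite WE in DC.
apply: etrans _ DC; apply: near_eq_derive.
have : \forall a \near u', (D' `&` X' @^-1` V) a.
  apply: open_nbhs_nbhs; split; last by split; rewrite //= E.
  exact: open_setI_preimage (chart_openD cX') (chart_contX cX') (chart_openV cX).
apply: filterS => a [D'a Va]; have [SX' _] := chart_in cX' D'a.
by have [b Db Xb] := chart_out cX SX' Va; rewrite /= -Xb (chart_ZX cX).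
Qed.
End Fields.

(** * Surface gradients and divergences in charts *)

Section SurfaceGradients.
Context {R : realType}.
Local Notation V2 := ('cV[R]_2).
Local Notation V3 := ('cV[R]_3).
Local Notation e0 := (delta_mx 0 0 : V2).
Local Notation e1 := (delta_mx 1 0 : V2).
Implicit Types (S : set V3) (nu : V3 -> V3) (phi : V3 -> R) (f : V3 -> V3).

Lemma extends_setI (W : normedModType R) k S (A : set V3) (f F : V3 -> W) p :
  open A -> A p -> extends k (S `&` A) f p F <-> extends k S f p F.
Proof.
move=> oA Ap; split=> [[V [[oV Vp] CF Ff]]|[V [[oV Vp] CF Ff]]].
  exists (V `&` A); split.
  - by split; [exact: openI|].
  - by apply: class_C_subset CF => x [].
  - by move=> x Sx [Vx Ax]; exact: Ff.
by exists V; split=> // x [Sx _]; exact: Ff.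
Qed.

Lemma field_C_setI (W : normedModType R) k S (A : set V3) (f : V3 -> W) :
  open A -> field_C k S f -> field_C k (S `&` A) f.
Proof.
move=> oA Cf p [Sp Ap]; have [F eF] := Cf p Sp.
by exists F; apply/extends_setI.
Qed.

Lemma vsgrad_setI S nu (A : set V3) f p : open A -> A p ->
  vsgrad (S `&` A) nu f p = vsgrad S nu f p.
Proof.
move=> oA Ap; congr (xget 0 _); apply/seteqP.
by split=> G [F [eF ->]]; exists F; split=> //; apply/(extends_setI _ _ _ _ oA Ap).
Qed.

Lemma sgrad_setI S nu (A : set V3) phi p : open A -> A p ->
  sgrad (S `&` A) nu phi p = sgrad S nu phi p.
Proof.
move=> oA Ap; congr (xget 0 _); apply/seteqP.
by split=> G [F [eF ->]]; exists F; split=> //; apply/(extends_setI _ _ _ _ oA Ap).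
Qed.

Lemma vsgrad_eq S nu f f' p : (forall q, S q -> f q = f' q) ->
  vsgrad S nu f p = vsgrad S nu f' p.
Proof.
move=> ff'; congr (xget 0 _); apply/seteqP.
by split=> G [F [[V [nV CF Ff]] ->]]; exists F; split=> //; exists V; split=> // x Sx Vx;
  rewrite Ff // ff'.
Qed.

Lemma field_CS (W : normedModType R) k S (f : V3 -> W) : field_C k.+1 S f -> field_C k S f.
Proof.
move=> Cf p Sp; have [F [V [nV CF Ff]]] := Cf p Sp.
by exists F, V; split=> //; exact: class_CS.
Qed.

Lemma oriented_setI S nu (A : set V3) : open A -> oriented_surface S nu ->
  oriented_surface (S `&` A) nu.
Proof.
move=> oA [sS Cn nn tn]; split.
- move=> p [Sp Ap]; have [D [V [X [Z [cX Vp]]]]] := sS p Sp.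
  by exists (D `&` X @^-1` A), (V `&` A), X, Z; split=> //; exact: chart_setI.
- exact: field_C_setI.
- by move=> p [Sp _]; exact: nn.
- move=> p v [Sp Ap] [D [V [X [Z [u [h [[[oD oV] CX CZ ZX E] Du Xu ->]]]]]]].
  apply: (tn p _ Sp); exists D, (A `&` V), X, Z, u, h; split=> //; split=> //.
  + by split=> //; exact: openI.
  + by apply: class_C_subset CZ => x [].
  + by rewrite E setIA.
Qed.

Lemma minimal_setI S nu (A : set V3) : open A -> minimal_surface S nu ->
  minimal_surface (S `&` A) nu.
Proof.
move=> oA [oS mS]; split; first exact: oriented_setI.
by move=> p [Sp Ap]; rewrite -(mS p Sp) /mean_curvature /sdiv vsgrad_setI.
Qed.

Lemma harmonic_setI S nu (A : set V3) phi : open A -> surface_harmonic S nu phi ->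
  surface_harmonic (S `&` A) nu phi.
Proof.
move=> oA [Cphi lphi]; split; first exact: field_C_setI.
move=> p [Sp Ap]; rewrite -(lphi p Sp) /slaplace /sdiv -(vsgrad_setI S nu _ oA Ap).
by congr (\tr _); apply: vsgrad_eq => q [_ Aq]; exact: sgrad_setI.
Qed.

Section Chart.
Variables (S : set V3) (nu : V3 -> V3).
Variables (D : set V2) (V : set V3) (X : V2 -> V3) (Z : V3 -> V2).
Hypothesis cX : chart S D V X Z.
Hypothesis oS : oriented_surface S nu.
Local Notation N := (nu \o X).

Lemma normal_C1 : class_C 1 N D.
Proof. by case: oS => _ Cn _ _; exact: (pullback_C_mx cX). Qed.

Lemma normal_unit u : D u -> dot (N u) (N u) = 1.
Proof. by case: oS => _ _ nn _ Du; apply: nn; case: (chart_in cX Du). Qed.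

Lemma normal_tangent u v : D u -> dot (N u) ('D_v X u) = 0.
Proof.
case: oS => _ _ _ tn Du; apply: tn; first by case: (chart_in cX Du).
by exists D, V, X, Z, u, v.
Qed.

Lemma frame_det u : D u -> dot (N u) (cross ('D_e0 X u) ('D_e1 X u)) != 0.
Proof.
move=> Du; apply: (frame_neq0 (M := jac Z (X u))); rewrite ?normal_tangent //.
- exact: normal_unit.
- exact: (chart_jac cX).
- exact: (chart_jac cX).
Qed.

(** A surface gradient annihilates the normal and is the differential along the
    surface, which a chart reads as the derivative of the pullback; no
    extension to space is involved in this description. *)
Lemma vsgradP f u : field_C 1 S f -> D u ->
  vsgrad S nu f (X u) *m N u = 0 /\
  forall v, vsgrad S nu f (X u) *m 'D_v X u = 'D_v (f \o X) u.
Proof.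
move=> Cf Du; have [SX _] := chart_in cX Du.
have [F eF] := Cf _ SX.
have [F' [eF' ->]] : [set G | exists F, extends 1 S f (X u) F /\
    G = vgrad F (X u) *m tanproj (nu (X u))] (vsgrad S nu f (X u)).
  by apply: xgetPex; exists (vgrad F (X u) *m tanproj (nu (X u))), F.
split=> [|v]; first by rewrite -mulmxA tanproj_normal ?mulmx0 // normal_unit.
have [dF' ->] := derive_pullback cX v Du eF'.
by rewrite -mulmxA tanproj_id ?normal_tangent // [RHS]jacE.
Qed.

Lemma tanproj_grad phi F u : extends 1 S phi (X u) F -> D u ->
  dot (N u) (tanproj (nu (X u)) *m grad F (X u)) = 0 /\
  forall v, dot (tanproj (nu (X u)) *m grad F (X u)) ('D_v X u) = 'D_v (phi \o X) u.
Proof.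
move=> eF Du; split=> [|v]; first by rewrite dot_tanproj // normal_unit.
have [dF ->] := derive_pullback cX v Du eF.
rewrite dotC dot_mulmx tanproj_tr tanproj_id ?normal_tangent //.
by rewrite [RHS]derive_cV //; apply: eq_bigr => i _; rewrite mxE.
Qed.

Lemma sgradP phi u : field_C 1 S phi -> D u ->
  dot (N u) (sgrad S nu phi (X u)) = 0 /\
  forall v, dot (sgrad S nu phi (X u)) ('D_v X u) = 'D_v (phi \o X) u.
Proof.
move=> Cf Du; have [SX _] := chart_in cX Du.
have [F eF] := Cf _ SX.
have [F' [eF' ->]] : [set g | exists F, extends 1 S phi (X u) F /\
    g = tanproj (nu (X u)) *m grad F (X u)] (sgrad S nu phi (X u)).
  by apply: xgetPex; exists (tanproj (nu (X u)) *m grad F (X u)), F.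
exact: tanproj_grad.
Qed.

Lemma sgrad_unique phi u g : field_C 1 S phi -> D u -> dot (N u) g = 0 ->
  (forall i, dot g ('D_(delta_mx i 0) X u) = 'D_(delta_mx i 0) (phi \o X) u) ->
  sgrad S nu phi (X u) = g.
Proof.
move=> Cf Du ng gX; have [nphi phiX] := sgradP Cf Du.
apply: (eq_dot_frame (frame_det Du)); last 2 first.
- by rewrite phiX gX.
- by rewrite phiX gX.
by rewrite dotC nphi dotC ng.
Qed.

Lemma vsgrad_unique f u G : field_C 1 S f -> D u -> G *m N u = 0 ->
  (forall i, G *m 'D_(delta_mx i 0) X u = 'D_(delta_mx i 0) (f \o X) u) ->
  vsgrad S nu f (X u) = G.
Proof.
move=> Cf Du Gn GX; have [nf fX] := vsgradP Cf Du.
by apply: (eq_mulmx_frame (frame_det Du)); rewrite ?nf ?Gn // fX GX.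
Qed.

Lemma sdivP f u : field_C 1 S f -> D u ->
  sdiv S nu f (X u) * dot (N u) (cross ('D_e0 X u) ('D_e1 X u)) =
  dot (N u) (cross ('D_e0 (f \o X) u) ('D_e1 X u) + cross ('D_e0 X u) ('D_e1 (f \o X) u)).
Proof.
move=> Cf Du; have [Gn GX] := vsgradP Cf Du.
apply: etrans (tr_cross _ _ _ _) _.
by rewrite Gn (GX e0) (GX e1) [dot 0 _]dotC dot0r addr0.
Qed.

(** In this form a vanishing divergence involves only derivatives in the plane. *)
Lemma sdiv_eq0 f u : field_C 1 S f -> D u ->
  sdiv S nu f (X u) = 0 <->
  dot (N u) (cross ('D_e0 (f \o X) u) ('D_e1 X u) + cross ('D_e0 X u) ('D_e1 (f \o X) u)) = 0.
Proof.
move=> Cf Du; rewrite -sdivP //; split=> [->|/eqP]; first by rewrite mul0r.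
by rewrite mulf_eq0 (negPf (frame_det Du)) orbF => /eqP.
Qed.

Lemma derivativeC1 (W : normedModType R) k (h : V2 -> W) u v :
  class_C k.+1 h D -> D u -> is_derive u v h ('D_v h u).
Proof.
by move=> Ch Du; apply/derivableP/diff_derivable; exact: class_C_differentiable Ch Du.
Qed.

Lemma derivativeXX u v w : D u -> is_derive u w ('D_v X) ('D_w ('D_v X) u).
Proof. by move=> Du; exact: derivativeC1 (class_C_derive v (chart_C2 cX)) Du. Qed.

Lemma derive_const_on (h : V2 -> R) c u v dh : (forall a, D a -> h a = c) -> D u ->
  is_derive u v h dh -> dh = 0.
Proof.
move=> hc Du [_ <-]; rewrite -(derive_cst c u v); apply: near_eq_derive.
exact: open_near_eq (chart_openD cX) hc Du.
Qed.

Lemma normal_dnormal u v : D u -> dot (N u) ('D_v N u) = 0.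
Proof.
move=> Du; have DN := derivativeC1 v normal_C1 Du.
have := derive_const_on normal_unit Du (is_derive_dot DN DN).
by rewrite [dot ('D_v N u) _]dotC -mulr2n => /eqP; rewrite mulrn_eq0 => /eqP.
Qed.

Lemma derive_commV n (h : V2 -> 'cV[R]_n) u v w : class_C 2 h D -> D u ->
  'D_w ('D_v h) u = 'D_v ('D_w h) u.
Proof.
move=> Ch Du; have oD := chart_openD cX.
have E v' w' i : ('D_w' ('D_v' h) u) i 0 = 'D_w' ('D_v' (fun a => h a i 0)) u.
  have Dh := derivativeC1 w' (class_C_derive v' Ch) Du.
  have [_ <-] := is_derive_coord i 0 Dh.
  apply: near_eq_derive; apply: open_near_eq oD _ Du => a Da.
  by have [_ <-] := is_derive_coord i 0 (derivativeC1 v' Ch Da).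
apply/colP => i; have C := derive_comm v w oD (class_C_coord i 0 oD Ch) Du.
exact: etrans (E v w i) (etrans C (esym (E w v i))).
Qed.

(** Differentiating N.X_i = 0 shows that N_j.X_i = - N.X_ij is symmetric. *)
Lemma curvature_sym u v w : D u -> dot ('D_v N u) ('D_w X u) = dot ('D_w N u) ('D_v X u).
Proof.
move=> Du.
have E a b : dot ('D_a N u) ('D_b X u) = - dot (N u) ('D_a ('D_b X) u).
  have DN := derivativeC1 a normal_C1 Du.
  have nt c : D c -> dot (N c) ('D_b X c) = 0 by exact: normal_tangent.
  have := derive_const_on nt Du (is_derive_dot DN (derivativeXX b a Du)).
  by move/eqP; rewrite addr_eq0 => /eqP.
have C := derive_commV w v (chart_C2 cX) Du.
exact: (etrans (E v w) (etrans (congr1 (fun t => - dot (N u) t) C) (esym (E w v)))).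
Qed.

Hypothesis mS : forall p, S p -> mean_curvature S nu p = 0.

Lemma minimal_eq u : D u ->
  dot (N u) (cross ('D_e0 N u) ('D_e1 X u) + cross ('D_e0 X u) ('D_e1 N u)) = 0.
Proof.
move=> Du; case: (oS) => _ Cn _ _; apply/(sdiv_eq0 Cn Du).
have [SX _] := chart_in cX Du; have /eqP := mS SX.
by rewrite /mean_curvature mulf_eq0 invr_eq0 pnatr_eq0 orbF => /eqP.
Qed.

End Chart.

Lemma chart_self S D (V : set V3) X Z : chart S D V X Z -> chart (S `&` V) D V X Z.
Proof. by move=> [oDV CX CZ ZX E]; split=> //; rewrite -setIA setIid. Qed.

(** A single extension of phi near p yields the surface gradient at all nearby
    points of S, because any extension may be used to compute it. *)
Lemma field_sgrad S nu phi : oriented_surface S nu -> field_C 2 S phi ->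
  field_C 1 S (sgrad S nu phi).
Proof.
move=> oS Cphi p Sp; have [sS Cn _ _] := oS.
have [n [A [[oA Ap] Cnu nE]]] := Cn p Sp.
have [F [B [[oB Bp] CF FE]]] := Cphi p Sp.
have oU : open (A `&` B) by exact: openI.
exists (fun x => tanproj (n x) *m grad F x), (A `&` B); split=> //.
  have Cn' : class_C 1 n (A `&` B) by apply: class_C_subset Cnu => x [].
  have CF' : class_C 2 F (A `&` B) by apply: class_C_subset CF => x [].
  have Cgrad : class_C 1 (grad F) (A `&` B).
    apply: class_C_mx => // j i.
    apply: class_C_eq oU _ (class_C_derive (delta_mx j 0) CF') => x _.
    by rewrite mxE.
  exact: (class_C_mulmx oU (class_C_tanproj oU Cn') Cgrad).
move=> x Sx [Ax Bx]; rewrite nE //.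
have [D [V [X [Z [cX Vx]]]]] := sS x Sx.
have [u Du Xu] := chart_out cX Sx Vx; rewrite -Xu.
have eF : extends 1 S phi (X u) F.
  by exists B; split=> //; [split; rewrite ?Xu|exact: class_CS].
have [nT TX] := tanproj_grad cX oS eF Du.
symmetry; apply: (sgrad_unique cX oS) => //; exact: field_CS.
Qed.

End SurfaceGradients.

(** * The closed forms defining the conjugate and the deformation *)

Section Existence.
Context {R : realType}.
Local Notation V2 := ('cV[R]_2).
Local Notation V3 := ('cV[R]_3).
Local Notation e0 := (delta_mx 0 0 : V2).
Local Notation e1 := (delta_mx 1 0 : V2).
Implicit Types (S : set V3) (nu y : V3 -> V3) (phi alpha : V3 -> R).

Definition is_conjugate nu phi S alpha :=
  surface_harmonic S nu alpha /\
  forall q, S q -> sgrad S nu alpha q = cross (nu q) (sgrad S nu phi q).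

Definition is_solution nu phi S alpha y :=
  bending_neutral S nu y /\
  forall q, S q -> vsgrad S nu y q =
    expR (phi q) *: (rotmx (nu q) (alpha q) *m tanproj (nu q)).

Definition turned_gradient S nu phi (X : V2 -> V3) u :=
  cross (nu (X u)) (sgrad S nu phi (X u)).

Definition deformation_form nu phi alpha (X : V2 -> V3) (i : 'I_2) u : V3 :=
  expR (phi (X u)) *: (cos (alpha (X u)) *: 'D_(delta_mx i 0) X u
    + sin (alpha (X u)) *: cross (nu (X u)) ('D_(delta_mx i 0) X u)).

(** Componentwise, on the smallest of the three balls. *)
Lemma poincare3 (w : 'I_2 -> V2 -> V3) D u0 :
  open D -> D u0 -> (forall i, class_C 1 (w i) D) ->
  (forall u, D u -> 'D_e1 (w 0) u = 'D_e0 (w 1) u) ->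
  exists r Y, [/\ 0 < r, ball u0 r `<=` D, class_C 2 Y (ball u0 r)
    & forall u i, ball u0 r u -> 'D_(delta_mx i 0) Y u = w i u].
Proof.
move=> oD Du0 Cw cl.
have H (l : 'I_3) : exists ra : R * (V2 -> R), [/\ 0 < ra.1, ball u0 ra.1 `<=` D,
    class_C 2 ra.2 (ball u0 ra.1)
    & forall u i, ball u0 ra.1 u -> 'D_(delta_mx i 0) ra.2 u = w i u l 0].
  have Cl i : class_C 1 (fun u => w i u l 0) D := class_C_coord l 0 oD (Cw i).
  have E i v u : D u -> 'D_v (fun u => w i u l 0) u = ('D_v (w i) u) l 0.
    move=> Du; have dw := diff_derivable (v := v) (class_C_differentiable (Cw i) Du).
    by have [_ ->] := is_derive_coord l 0 (derivableP dw).
  have [u Du|r [a [r0 rD Ca da]]] := poincare (w := fun i u => w i u l 0) oD Du0 Cl.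
    by apply: etrans (E 0 e1 u Du) (etrans _ (esym (E 1 e0 u Du))); rewrite cl.
  by exists (r, a).
have [ra Hra] := choice H.
pose r := Num.min (ra 0).1 (Num.min (ra 1).1 (ra 2).1).
have r0 : 0 < r.
  by rewrite !lt_min; have [-> _ _ _] := Hra 0; have [-> _ _ _] := Hra 1;
     have [-> _ _ _] := Hra 2.
have rb l : ball u0 r `<=` ball u0 (ra l).1.
  by apply: le_ball; move: l; apply: I3P; rewrite /r !ge_min lexx ?orbT.
have ob : open (ball u0 r) by exact: ball_open.
pose Y u : V3 := \col_l (ra l).2 u.
have CY : class_C 2 Y (ball u0 r).
  apply: class_C_mx => // l j; have [_ _ Ca _] := Hra l.
  apply: (class_C_eq (f := (ra l).2) ob) => [u _|]; first by rewrite mxE.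
  exact: class_C_subset (rb l) Ca.
exists r, Y; split=> //.
  by move=> u /(rb 0); have [_ + _ _] := Hra 0; exact.
move=> u i bu; have dY := class_C_differentiable CY bu.
have Yl l : (fun a => Y a l 0) = (ra l).2 by apply/funext => a; rewrite mxE.
have DY := derivableP (diff_derivable (v := delta_mx i 0) dY).
apply/colP => l; have [_ Dl] := is_derive_coord l 0 DY; rewrite Yl in Dl.
have [_ _ _ Hl] := Hra l; exact: etrans (esym Dl) (Hl u i (rb l u bu)).
Qed.

Section Chart.
Variables (S : set V3) (nu : V3 -> V3) (phi : V3 -> R).
Hypothesis mS : minimal_surface S nu.
Hypothesis hphi : surface_harmonic S nu phi.
Variables (D : set V2) (V : set V3) (X : V2 -> V3) (Z : V3 -> V2).
Hypothesis cX : chart S D V X Z.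
Local Notation N := (nu \o X).
Local Notation g := (sgrad S nu phi \o X).
Local Notation h := (turned_gradient S nu phi X).

Let oS : oriented_surface S nu. Proof. by case: mS. Qed.
Let oD : open D. Proof. exact: chart_openD cX. Qed.
Let Cphi : field_C 1 S phi. Proof. by apply: field_CS; case: hphi. Qed.
Let CN : class_C 1 N D. Proof. exact: normal_C1 cX oS. Qed.
Let min u := minimal_eq cX oS (proj2 mS) (u := u).

Let nn u (Du : D u) := normal_unit cX oS Du.
Let nX u v (Du : D u) := normal_tangent cX oS v Du.
Let nN u v (Du : D u) := normal_dnormal cX oS v Du.

Let CdX v : class_C 1 ('D_v X) D.
Proof. exact: class_C_derive (chart_C2 cX). Qed.

Lemma gradient_C1 : class_C 1 g D.
Proof. by apply: (pullback_C_mx cX) => //; apply: field_sgrad => //; case: hphi. Qed.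
Let Cg := gradient_C1.

Lemma gradient_normal u : D u -> dot (N u) (g u) = 0.
Proof. by move=> Du; have [] := sgradP cX oS Cphi Du. Qed.

Lemma gradientE u v : D u -> dot (g u) ('D_v X u) = 'D_v (phi \o X) u.
Proof. by move=> Du; have [_] := sgradP cX oS Cphi Du; exact. Qed.

Lemma harmonic_eq u : D u ->
  dot (N u) (cross ('D_e0 g u) ('D_e1 X u) + cross ('D_e0 X u) ('D_e1 g u)) = 0.
Proof.
move=> Du; case: hphi => C2phi lphi.
apply/(sdiv_eq0 cX oS (field_sgrad oS C2phi) Du).
by apply: lphi; case: (chart_in cX Du).
Qed.

(** Differentiating g.X_i = (phi o X)_i, where second derivatives are symmetric. *)
Lemma hessian_sym u v w : D u -> dot ('D_v X u) ('D_w g u) = dot ('D_w X u) ('D_v g u).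
Proof.
move=> Du; have C2 : class_C 2 (phi \o X) D by apply: (pullback_C cX) => //; case: hphi.
have E a b : dot ('D_b g u) ('D_a X u) + dot (g u) ('D_b ('D_a X) u)
    = 'D_b ('D_a (phi \o X)) u.
  have [_ <-] := is_derive_dot (derivativeC1 b Cg Du) (derivativeXX cX a b Du).
  apply: near_eq_derive; apply: open_near_eq oD _ Du => c Dc; exact: gradientE.
have C := derive_comm v w oD C2 Du.
have XX := derive_commV cX v w (chart_C2 cX) Du.
have H := etrans (E v w) (etrans C (esym (E w v))); rewrite XX in H.
move/addIr: H => H; exact: (etrans (dotC _ _) (etrans H (dotC _ _))).
Qed.

Lemma dconjugate u v : D u -> is_derive u v h (cross ('D_v N u) (g u) + cross (N u) ('D_v g u)).
Proof. by move=> Du; exact: is_derive_cross (derivativeC1 v CN Du) (derivativeC1 v Cg Du). Qed.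

Lemma conjugate_C1 : class_C 1 h D.
Proof. exact: (class_C_cross oD CN Cg). Qed.

Lemma conjugate_form_closed u : D u ->
  'D_e1 (fun u => dot (h u) ('D_e0 X u)) u = 'D_e0 (fun u => dot (h u) ('D_e1 X u)) u.
Proof.
move=> Du.
have [_ D1] := is_derive_dot (dconjugate e1 Du) (derivativeXX cX e0 e1 Du).
have [_ D0] := is_derive_dot (dconjugate e0 Du) (derivativeXX cX e1 e0 Du).
have XX := derive_commV cX e0 e1 (chart_C2 cX) Du.
have C := conjugate_closed (g u) (nn Du) (nX e0 Du) (nX e1 Du) (nN e0 Du) (nN e1 Du)
  (min Du) (harmonic_eq Du).
exact: (etrans D1 (etrans (congr2 +%R C (congr1 (dot (h u)) XX)) (esym D0))).
Qed.

(** A field whose differential is (N x g).dX has surface gradient N x g, and the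
    divergence of the latter is the antisymmetric part of the Hessian. *)
Lemma sgrad_conjugateP alpha : field_C 2 S alpha ->
  (forall u i, D u -> 'D_(delta_mx i 0) (alpha \o X) u = dot (h u) ('D_(delta_mx i 0) X u)) ->
  forall u, D u -> sgrad S nu alpha (X u) = h u /\ slaplace S nu alpha (X u) = 0.
Proof.
move=> C2 dalpha; have C1 := field_CS C2.
have E u : D u -> sgrad S nu alpha (X u) = h u.
  move=> Du; apply: (sgrad_unique cX oS) => // [|i]; last by rewrite dalpha.
  exact: dot_crossl.
move=> u Du; split; first exact: E.
apply/(sdiv_eq0 cX oS (field_sgrad oS C2) Du).
have dE v : 'D_v (sgrad S nu alpha \o X) u = cross ('D_v N u) (g u) + cross (N u) ('D_v g u).
  have [_ dh] := dconjugate v Du; apply: etrans _ dh; apply: near_eq_derive.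
  exact: open_near_eq oD E Du.
rewrite (dE e0) (dE e1).
exact: (conjugate_harmonic (nn Du) (nX e0 Du) (nX e1 Du) (nN e0 Du) (nN e1 Du)
  (gradient_normal Du) (hessian_sym e0 e1 Du)).
Qed.

Section Deformation.
Variable alpha : V3 -> R.
Hypothesis halpha : is_conjugate nu phi S alpha.

Local Notation b := (phi \o X).
Local Notation al := (alpha \o X).
Local Notation w := (deformation_form nu phi alpha X).
Let Cb : class_C 2 b D.
Proof. by apply: (pullback_C cX) => //; case: hphi. Qed.

Let Cal : class_C 2 al D.
Proof. by apply: (pullback_C cX) => //; case: halpha => -[]. Qed.

Lemma dalphaE u v : D u -> 'D_v al u = dot (h u) ('D_v X u).
Proof.
move=> Du; case: halpha => -[C2 _] E.
have [_ <-] := sgradP cX oS (field_CS C2) Du.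
by rewrite E //; case: (chart_in cX Du).
Qed.

Lemma deformation_form_C1 i : class_C 1 (w i) D.
Proof.
have [Cc Cs] := class_C_cos_sin oD (class_CS Cal).
have CdXi := CdX (delta_mx i 0).
exact: (class_C_scale oD (class_C_expR oD (class_CS Cb))
  (class_CD oD (class_C_scale oD Cc CdXi)
     (class_C_scale oD Cs (class_C_cross oD CN CdXi)))).
Qed.

Lemma deformation_form_derive u i v : D u -> is_derive u v (w i)
  (expR (b u) *: ('D_v b u *: (cos (al u) *: 'D_(delta_mx i 0) X u
       + sin (al u) *: cross (N u) ('D_(delta_mx i 0) X u)) +
     ((- sin (al u) * 'D_v al u) *: 'D_(delta_mx i 0) X u
       + cos (al u) *: 'D_v ('D_(delta_mx i 0) X) u
       + ((cos (al u) * 'D_v al u) *: cross (N u) ('D_(delta_mx i 0) X u)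
       + sin (al u) *: (cross ('D_v N u) ('D_(delta_mx i 0) X u)
                      + cross (N u) ('D_v ('D_(delta_mx i 0) X) u)))))).
Proof.
move=> Du.
have db := class_C_differentiable Cb Du; have dal := class_C_differentiable Cal Du.
have De := is_derive_comp1 v db (is_derive_expR (b u)).
have Dc := is_derive_comp1 v dal (is_derive_cos (al u)).
have Ds := is_derive_comp1 v dal (is_derive_sin (al u)).
have DXX := derivativeXX cX (delta_mx i 0) v Du.
have DNX := is_derive_cross (derivativeC1 v CN Du) DXX.
apply: is_derive_eq (is_derive_scale De
  (is_deriveD (is_derive_scale Dc DXX) (is_derive_scale Ds DNX))) _.
have sc (e d : R) (A B : V3) : (e * d) *: A + e *: B = e *: (d *: A + B).
  by rewrite scalerDr scalerA.
exact: sc.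
Qed.

Lemma deformation_form_closed u : D u -> 'D_e1 (w 0) u = 'D_e0 (w 1) u.
Proof.
move=> Du.
have [_ D1] := deformation_form_derive 0 e1 Du.
have [_ D0] := deformation_form_derive 1 e0 Du.
have XX := derive_commV cX e0 e1 (chart_C2 cX) Du.
have C := deformation_closed (nn Du) (nX e0 Du) (nX e1 Du) (nN e0 Du) (nN e1 Du)
  (gradient_normal Du) (min Du) (expR (b u)) (cos (al u)) (sin (al u))
  (esym (gradientE e0 Du)) (esym (gradientE e1 Du)) (dalphaE e0 Du) (dalphaE e1 Du) XX.
exact: (etrans D1 (etrans C (esym D0))).
Qed.

End Deformation.
End Chart.
End Existence.

(** * Local existence of the conjugate; local embeddings *)

Section LocalExistence.
Context {R : realType}.
Local Notation V2 := ('cV[R]_2).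
Local Notation V3 := ('cV[R]_3).
Local Notation e0 := (delta_mx 0 0 : V2).
Local Notation e1 := (delta_mx 1 0 : V2).
Implicit Types (S T : set V3) (nu y : V3 -> V3) (phi alpha : V3 -> R).

Lemma conjugate_exists S nu phi p : minimal_surface S nu -> surface_harmonic S nu phi ->
  S p -> exists V alpha, open_nbhs p V /\ is_conjugate nu phi (S `&` V) alpha.
Proof.
move=> mS hphi Sp; have [oS _] := mS; have [sS _ _ _] := oS.
have [D [V [X [Z [cX Vp]]]]] := sS p Sp.
have [u0 Du0 Xu0] := chart_out cX Sp Vp.
have oD := chart_openD cX.
have Cw i : class_C 1 (fun u => dot (turned_gradient S nu phi X u) ('D_(delta_mx i 0) X u)) D.
  exact: (class_C_dot oD (conjugate_C1 mS hphi cX) (class_C_derive _ (chart_C2 cX))).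
have [u Du|r [a [r0 bD Ca da]]] := poincare oD Du0 Cw.
  exact: (conjugate_form_closed mS hphi cX Du).
have ob : open (ball u0 r) by exact: ball_open.
have [cXr E] := chart_restrict cX ob bD.
set W := V `&` Z @^-1` ball u0 r in cXr E.
have oW : open W := chart_openV cXr.
have cT := chart_self cXr.
have aX u : ball u0 r u -> a u = ((a \o Z) \o X) u.
  by move=> bu; rewrite /= (chart_ZX cXr bu).
have Cal : class_C 2 ((a \o Z) \o X) (ball u0 r) := class_C_eq ob aX Ca.
exists W, (a \o Z); split.
  split=> //; have [_ +] := chart_in cXr (ballxx u0 r0); by rewrite Xu0.
have C2 : field_C 2 (S `&` W) (a \o Z).
  move=> q [Sq Wq]; have [u bu <-] := chart_out cXr Sq Wq.
  exact: (field_of_pullback cT _ bu Cal).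
have mT := minimal_setI oW mS; have hT := harmonic_setI oW hphi.
have dal u i : ball u0 r u -> 'D_(delta_mx i 0) ((a \o Z) \o X) u =
    dot (turned_gradient (S `&` W) nu phi X u) ('D_(delta_mx i 0) X u).
  move=> bu; rewrite /turned_gradient sgrad_setI //; last by case: (chart_in cXr bu).
  apply: etrans _ (da u i bu); apply: esym; apply: near_eq_derive.
  exact: open_near_eq ob aX bu.
have H q : (S `&` W) q -> sgrad (S `&` W) nu (a \o Z) q =
    cross (nu q) (sgrad (S `&` W) nu phi q) /\ slaplace (S `&` W) nu (a \o Z) q = 0.
  move=> [Sq Wq]; have [u bu <-] := chart_out cXr Sq Wq.
  exact: (sgrad_conjugateP mT hT cT C2 dal bu).
by split=> [|q /H[]//]; split=> // q /H[].
Qed.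

(** A ball is the union of the segments from its centre. *)
Lemma connected_ball (u0 : V2) (r : R) : 0 < r -> connected (ball u0 r).
Proof.
move=> r0; have -> : ball u0 r =
    \bigcup_(u in ball u0 r) ((fun t : R => u0 + t *: (u - u0)) @` `[0, 1]).
  apply/seteqP; split=> [u bu|_ [u bu [t + <-]]].
    exists u => //; exists 1; first by rewrite /= in_itv /= ler01 lexx.
    by rewrite scale1r addrC subrK.
  by rewrite /= in_itv /= => t01; apply: ball_segment => //; exact: ballxx.
apply: bigcup_connected.
  exists u0 => u _; exists 0; first by rewrite /= in_itv /= ler01 lexx.
  by rewrite scale0r addr0.
move=> u _; apply: connected_continuous_connected; first exact: segment_connected.
apply: continuous_subspaceT => t; exact: continuous_line.
Qed.

Lemma field_C_within (W : normedModType R) S (f : V3 -> W) k p :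
  field_C k S f -> S p -> f @ within S (nbhs p) --> f p.
Proof.
move=> Cf Sp; have [F [V [[oV Vp] CF Ff]]] := Cf p Sp.
have cF : {for p, continuous F} := class_C_continuous CF Vp.
rewrite -(Ff p Sp Vp) => A nA.
have nV : nbhs p V by exact: open_nbhs_nbhs (conj oV Vp).
have nFA : nbhs p (F @^-1` A) := cF A nA.
suff : nbhs p (fun x => S x -> A (f x)) by exact.
by near=> x => Sx; rewrite -Ff //; near: x.
Unshelve. all: by end_near.
Qed.

Lemma embedding_subset S T y : T `<=` S -> embedding S y -> embedding T y.
Proof.
move=> TS [cy [z [zy cz]]]; split; first exact: continuous_subspaceW TS cy.
exists z; split=> [p /TS|]; first exact: zy.
by apply: continuous_subspaceW cz; exact: image_subset.
Qed.

(** The inverse of y is X o Zy, which is continuous on an open set of space. *)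
Lemma embedding_chart S D (V : set V3) X Z k y V0 Zy : chart S D V X Z ->
  field_C k S y -> open V0 -> class_C 2 Zy V0 -> (forall q, V0 q -> D (Zy q)) ->
  (forall u, D u -> V0 (y (X u)) /\ Zy (y (X u)) = u) -> embedding (S `&` V) y.
Proof.
move=> cX Cy oV0 CZ V0D V0y; split.
  apply/subspace_continuousP => p [Sp Vp].
  apply: cvg_trans (field_C_within Cy Sp).
  by apply: cvg_app; apply: within_subset => x [].
exists (X \o Zy); split=> [p [Sp Vp]|].
  have [u Du <-] := chart_out cX Sp Vp.
  by rewrite /= (V0y u Du).2.
apply: continuous_in_subspaceT => q; rewrite inE => -[p [Sp Vp] <-].
have [u Du <-] := chart_out cX Sp Vp; have [V0u _] := V0y u Du.
apply: continuous_comp; first exact: class_C_continuous CZ V0u.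
apply: (chart_contX cX); exact: V0D.
Qed.

Section Solution.
Variables (S : set V3) (nu : V3 -> V3) (phi alpha : V3 -> R) (y : V3 -> V3).
Hypothesis oS : oriented_surface S nu.
Variables (D : set V2) (V : set V3) (X : V2 -> V3) (Z : V3 -> V2).
Hypothesis cX : chart S D V X Z.
Local Notation N := (nu \o X).

Lemma stretch_tangent u v : D u ->
  (expR (phi (X u)) *: (rotmx (N u) (alpha (X u)) *m tanproj (N u))) *m 'D_v X u =
  expR (phi (X u)) *: (cos (alpha (X u)) *: 'D_v X u
     + sin (alpha (X u)) *: cross (N u) ('D_v X u)).
Proof.
move=> Du; have nv := normal_tangent cX oS v Du.
by rewrite -scalemxAl -mulmxA tanproj_id // rotmx_tangent.
Qed.

Lemma solution_derive u v : is_solution nu phi S alpha y -> D u ->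
  'D_v (y \o X) u = expR (phi (X u)) *: (cos (alpha (X u)) *: 'D_v X u
     + sin (alpha (X u)) *: cross (N u) ('D_v X u)).
Proof.
move=> [[[Cy _] _] Ey] Du; have [SX _] := chart_in cX Du.
have [_ <-] := vsgradP cX oS (field_CS Cy) Du.
by rewrite Ey // stretch_tangent.
Qed.

Lemma solution_of_derive : field_C 2 S y -> X @` D = S ->
  (forall u i, D u -> 'D_(delta_mx i 0) (y \o X) u = deformation_form nu phi alpha X i u) ->
  is_solution nu phi S alpha y.
Proof.
move=> Cy XS dy.
have E q : S q -> vsgrad S nu y q =
    expR (phi q) *: (rotmx (nu q) (alpha q) *m tanproj (nu q)).
  rewrite -{1}XS => -[u Du <-]; apply: (vsgrad_unique cX oS (field_CS Cy) Du).
    by rewrite -scalemxAl -mulmxA tanproj_normal ?mulmx0 ?scaler0 // (normal_unit cX oS).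
  by move=> i; rewrite stretch_tangent // dy.
have [_ _ nn _] := oS.
split=> //; split; first split=> // q Sq.
  exists (rotmx (nu q) (alpha q)), (expR (phi q) *: tanproj (nu q)).
  by rewrite E //; apply: polar_conformal; rewrite ?nn ?expR_gt0 //; exact: rotmx_rotation (nn q Sq).
move=> q Q U Sq; rewrite E // => pol.
have : (X @` D) q by rewrite XS.
move=> [u Du Xu]; move: pol (nn q Sq); rewrite -Xu => pol nnu.
apply: (polar_conformal_normal nnu (expR_gt0 _) (rotmx_rotation _ nnu)
  (rotmx_normal _ nnu) _ _ (frame_det cX oS Du) pol); exact: (normal_tangent cX oS).
Qed.

(** The Jacobian of Z is a left inverse of the differential of X, and the rotation
    is inverted by its transpose. *)
Lemma solution_left_inverse u : is_solution nu phi S alpha y -> D u ->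
  forall v, (expR (- phi (X u)) *: (jac Z (X u) *m (rotmx (N u) (alpha (X u)))^T))
     *m 'D_v (y \o X) u = v.
Proof.
move=> sol Du v; rewrite solution_derive //.
have nv := normal_tangent cX oS v Du.
rewrite -rotmx_tangent // -scalemxAl -scalemxAr scalerA -expRD addNr expR0 scale1r.
have [QQ _] := rotmx_rotation (alpha (X u)) (normal_unit cX oS Du).
by rewrite -mulmxA (mulmxA _^T) QQ mul1mx (chart_jac cX).
Qed.

End Solution.
End LocalExistence.

(** * Deformations: existence, uniqueness, minimality of the image *)

Section Deformations.
Context {R : realType}.
Local Notation V2 := ('cV[R]_2).
Local Notation V3 := ('cV[R]_3).
Local Notation e0 := (delta_mx 0 0 : V2).
Local Notation e1 := (delta_mx 1 0 : V2).
Implicit Types (S T : set V3) (nu y : V3 -> V3) (phi alpha : V3 -> R).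

Lemma solution_embedding S nu phi alpha y p : oriented_surface S nu ->
  is_solution nu phi S alpha y -> S p -> exists W, open_nbhs p W /\ embedding (S `&` W) y.
Proof.
move=> oS sol Sp; have [sS _ _ _] := oS.
have [D [V [X [Z [cX Vp]]]]] := sS p Sp.
have [u0 Du0 Xu0] := chart_out cX Sp Vp.
have Cy : field_C 2 S y by case: sol => -[[]].
have [D0 [V0 [Zy [[[oD0 D0u0] D0D] oV0 CZ V0D V0y]]]] :=
  immersion_left_inverse (chart_openD cX) Du0 (pullback_C_mx cX (leqnn 2) Cy)
    (solution_left_inverse oS cX sol Du0).
have [cX0 _] := chart_restrict cX oD0 D0D.
exists (V `&` Z @^-1` D0); split.
  by split; [exact: chart_openV cX0|rewrite -Xu0; case: (chart_in cX0 D0u0)].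
exact: (embedding_chart cX0 Cy oV0 CZ V0D V0y).
Qed.

(** The form e^phi R(alpha) dX is closed; composing its primitive Y on a ball of the
    parameter plane with Z gives y.  A smaller ball makes y an embedding, and its
    image under X is connected. *)
Lemma deformation_exists S nu phi alpha p : minimal_surface S nu ->
  surface_harmonic S nu phi -> is_conjugate nu phi S alpha -> S p ->
  exists W y, [/\ open_nbhs p W, connected (S `&` W), embedding (S `&` W) y
    & is_solution nu phi (S `&` W) alpha y].
Proof.
move=> mS hphi halpha Sp; have [oS _] := mS; have [sS _ _ _] := oS.
have [D [V [X [Z [cX Vp]]]]] := sS p Sp.
have [u0 Du0 Xu0] := chart_out cX Sp Vp.
have oD := chart_openD cX.
have [r [Y [r0 bD CY dY]]] := poincare3 oD Du0 (deformation_form_C1 mS hphi cX halpha)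
  (fun u => @deformation_form_closed _ _ _ _ mS hphi _ _ _ _ cX _ halpha u).
have ob : open (ball u0 r) by exact: ball_open.
pose y := Y \o Z.
have sol B : open B -> B `<=` ball u0 r ->
    let W := V `&` Z @^-1` B in [/\ chart S B W X Z, S `&` W = X @` B
      & is_solution nu phi (S `&` W) alpha y].
  move=> oB Bb W; have [cXB E] := chart_restrict cX oB (subset_trans Bb bD).
  have cT := chart_self cXB; split=> //.
  have yX u : B u -> Y u = (y \o X) u by move=> Bu; rewrite /= /y /= (chart_ZX cXB Bu).
  apply: (solution_of_derive (oriented_setI (chart_openV cXB) oS) cT).
  - move=> q [Sq Wq]; have [u Bu <-] := chart_out cXB Sq Wq.
    exact: (field_of_pullback_mx cT _ Bu (class_C_eq oB yX (class_C_subset Bb CY))).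
  - by rewrite E.
  - move=> u i Bu; apply: etrans _ (dY u i (Bb u Bu)); apply: esym.
    exact: near_eq_derive (open_near_eq oB yX Bu).
have [c1 E1 sol1] := sol _ ob (fun _ => id).
set W1 := V `&` _ in c1 E1 sol1.
have [SXu0 W1Xu0] := chart_in c1 (ballxx u0 r0).
have [W0 [[oW0 W0p] emb]] := solution_embedding (oriented_setI (chart_openV c1) oS)
  sol1 (conj SXu0 W1Xu0).
have oB' := open_setI_preimage ob (fun u bu => chart_contX cX (bD u bu)) oW0.
have nB' : nbhs u0 (ball u0 r `&` X @^-1` W0).
  by apply: open_nbhs_nbhs; split=> //; split=> //; exact: ballxx.
have [r1 /= r10 br1] := (nbhs_ballP _ _).1 nB'.
have ob1 : open (ball u0 r1) by exact: ball_open.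
have [c2 E2 sol2] := sol _ ob1 (fun u bu => (br1 u bu).1).
exists (V `&` Z @^-1` ball u0 r1), y; split=> //.
- split; first exact: chart_openV c2.
  by rewrite -Xu0; case: (chart_in c2 (ballxx u0 r10)).
- rewrite E2; apply: connected_continuous_connected; first exact: connected_ball.
  apply: continuous_in_subspaceT => u; rewrite inE => bu; exact: (chart_contX c2).
- apply: embedding_subset emb; rewrite E2 => _ [u bu <-].
  have [bu1 W0u] := br1 u bu; have [SX W1X] := chart_in c1 bu1.
  exact: (conj (conj SX W1X) W0u).
Qed.

(** Two solutions have the same surface gradient, so their difference is locally
    constant. *)
Lemma solution_unique S nu phi alpha y1 y2 : oriented_surface S nu -> connected S ->
  is_solution nu phi S alpha y1 -> is_solution nu phi S alpha y2 ->
  exists c, forall q, S q -> y2 q = y1 q + c.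
Proof.
move=> oS conS sol1 sol2; have [sS _ _ _] := oS.
have loc p : S p -> exists W, open_nbhs p W /\
    forall q, S q -> W q -> y2 q - y1 q = y2 p - y1 p.
  move=> Sp; have [D [V [X [Z [cX Vp]]]]] := sS p Sp.
  have [u0 Du0 Xu0] := chart_out cX Sp Vp.
  have nD : nbhs u0 D by exact: open_nbhs_nbhs (conj (chart_openD cX) Du0).
  have [r /= r0 bD] := (nbhs_ballP _ _).1 nD.
  have ob : open (ball u0 r) by exact: ball_open.
  have [c E] := chart_restrict cX ob bD.
  exists (V `&` Z @^-1` ball u0 r); split.
    split; first exact: chart_openV c.
    by rewrite -Xu0; case: (chart_in c (ballxx u0 r0)).
  move=> q Sq Wq; have [u bu <-] := chart_out c Sq Wq; rewrite -Xu0.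
  pose f a : V3 := y2 (X a) - y1 (X a).
  have C1 : class_C 2 (y1 \o X) D.
    by apply: (pullback_C_mx cX) => //; case: sol1 => -[[]].
  have C2 : class_C 2 (y2 \o X) D.
    by apply: (pullback_C_mx cX) => //; case: sol2 => -[[]].
  have df a v : D a -> is_derive a v f 0.
    move=> Da; have D1 := derivativeC1 v C1 Da; have D2 := derivativeC1 v C2 Da.
    rewrite (solution_derive oS cX v sol1 Da) in D1.
    rewrite (solution_derive oS cX v sol2 Da) in D2.
    by apply: is_derive_eq (is_deriveB D2 D1) _; rewrite subrr.
  have bt (t : R) : 0 <= t <= 1 -> D (u0 + t *: (u - u0)).
    by move=> t01; apply: bD; apply: ball_segment => //; exact: ballxx.
  suff : f u = f u0 by [].
  apply/colP => l; apply/eqP; rewrite -subr_eq0; apply/eqP.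
  have dl (t : R) : 0 <= t <= 1 ->
      is_derive (u0 + t *: (u - u0)) (u - u0) (fun a => f a l 0) 0.
    move=> t01; have := is_derive_coord l 0 (df _ (u - u0) (bt t t01)).
    by rewrite mxE.
  have [t t01|t t01] := @mvt_segment _ _ (fun a => f a l 0) u0 (u - u0).
    by have [] := dl t t01.
  by have [_ ->] := dl t t01; rewrite [u0 + _]addrC subrK.
have [[p0 Sp0]|S0] := pselect (exists p, S p); last first.
  by exists 0 => q Sq; case: S0; exists q.
pose c := y2 p0 - y1 p0; exists c.
(* the set where y2 - y1 = c is relatively open, and so is its complement *)
pose O (P : V3 -> Prop) := \bigcup_(W in [set W | open W /\
  forall q, S q -> W q -> P (y2 q - y1 q)]) W.
have oO P : open (O P) by apply: bigcup_open => W [].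
have OP P q : S q -> O P q <-> P (y2 q - y1 q).
  move=> Sq; split=> [[W [_ WP] Wq]|Pq]; first exact: WP.
  have [W [[oW Wq] WE]] := loc q Sq; exists W => //; split=> // q' Sq' Wq'.
  by rewrite WE.
have AS : S `&` O (fun v => v = c) = S.
  apply: conS.
  - by exists p0; split=> //; apply/OP.
  - by exists (O (fun v => v = c)).
  - exists (~` O (fun v => v <> c)); first exact: open_closedC.
    apply/seteqP; split=> q [Sq Oq]; split=> //.
      by move=> On; exact: ((OP _ q Sq).1 On ((OP _ q Sq).1 Oq)).
    apply: (OP (fun v => v = c) q Sq).2; apply: contrapT => H; apply: Oq.
    exact: (OP (fun v => v <> c) q Sq).2 H.
move=> q Sq; have [_ Oq] : (S `&` O (fun v => v = c)) q by rewrite AS.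
by have /= <- := (OP (fun v => v = c) q Sq).1 Oq; rewrite addrC subrK.
Qed.

Section Image.
Variables (S : set V3) (nu : V3 -> V3) (phi alpha : V3 -> R) (y : V3 -> V3).
Hypothesis mS : minimal_surface S nu.
Hypothesis sol : is_solution nu phi S alpha y.
Variables (A : set V3) (z : V3 -> V3).
Hypothesis oA : open A.
Hypothesis zy : forall p, (S `&` A) p -> z (y p) = p.
Hypothesis cz : {within y @` (S `&` A), continuous z}.
Local Notation S' := (y @` (S `&` A)).
Let oS : oriented_surface S nu. Proof. by case: mS. Qed.

(** A chart of S composed with y is a chart of the image: a left inverse of the
    immersion inverts it, and continuity of the inverse of y makes the image of
    a small piece of S relatively open. *)
Lemma image_chart p : (S `&` A) p -> exists D V X Z D0 V1 Zy u,
  [/\ chart S D V X Z, D0 `<=` D /\ (forall a, D0 a -> A (X a)),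
      chart S' D0 V1 (y \o X) Zy, D0 u /\ X u = p & V1 (y p)].
Proof.
move=> [Sp Ap]; have [sS _ _ _] := oS.
have [D [V [X [Z [cX Vp]]]]] := sS p Sp.
have [u0 Du0 Xu0] := chart_out cX Sp Vp.
have cA := chart_setI cX oA.
have D'u0 : (D `&` X @^-1` A) u0 by split; rewrite //= Xu0.
have oD' := chart_openD cA.
have Cy : field_C 2 S y by case: sol => -[[]].
have Dsub : D `&` X @^-1` A `<=` D by move=> u [].
have C2 := class_C_subset Dsub (pullback_C_mx cX (leqnn 2) Cy).
have [D0 [V0 [Zy [[[oD0 D0u0] D0D] oV0 CZ V0D V0y]]]] :=
  immersion_left_inverse oD' D'u0 C2 (solution_left_inverse oS cX sol Du0).
have [cA0 E] := chart_restrict cA oD0 D0D.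
set W0 := (V `&` A) `&` Z @^-1` D0 in cA0 E.
(* z maps the part of the image in the interior of P into the chart of S *)
pose P q := S' q -> W0 (z q).
have zW q : S' q -> W0 (z q) -> (P : set V3)° q.
  move=> Sq Wq; have /subspace_continuousP/(_ q Sq) cq := cz.
  have nW : nbhs (z q) W0.
    by apply: open_nbhs_nbhs; split=> //; exact: chart_openV cA0.
  exact: (cq W0 nW).
have inS u : D0 u -> S' (y (X u)) /\ (P : set V3)° (y (X u)).
  move=> D0u; have [SA W0u] := chart_in cA0 D0u.
  by split; [exists (X u)|apply: zW; [exists (X u)|rewrite zy]].
exists D, V, X, Z, D0, (V0 `&` (P : set V3)°), Zy, u0; split=> //.
- by split=> u /D0D[].
- split=> //.
  + by split=> //; apply: openI => //; exact: open_interior.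
  + exact: class_C_subset D0D C2.
  + by apply: class_C_subset CZ => q [].
  + by move=> u /V0y[].
  + apply/seteqP; split=> [_ [u D0u <-]|q [Sq [V0q Pq]]].
      by have [SX PX] := inS u D0u; split=> //; split=> //; case: (V0y u D0u).
    have Wz : W0 (z q) := interior_subset Pq Sq.
    case: Sq Wz {V0q Pq} => p' SAp' <-; rewrite zy // => W0p'.
    have : (X @` D0) p' by rewrite -E.
    by move=> [u D0u <-]; exists u.
- by split; [rewrite -Xu0; case: (V0y u0 D0u0)|rewrite -Xu0; case: (inS u0 D0u0)].
Qed.

Lemma image_oriented : oriented_surface S' (nu \o z).
Proof.
have [_ _ nn _] := oS; split.
- move=> _ [p SAp <-].
  by have [D [V [X [Z [D0 [V1 [Zy [u [_ _ c _ V1p]]]]]]]]] := image_chart SAp;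
    exists D0, V1, (y \o X), Zy.
- move=> _ [p SAp <-].
  have [D [V [X [Z [D0 [V1 [Zy [u [cX [D0D AX] c [D0u <-] _]]]]]]]]] := image_chart SAp.
  apply: (field_of_pullback_mx c _ D0u) => //.
  apply: (class_C_eq (f := nu \o X) (chart_openD c)) => [a D0a|].
    rewrite /= zy //; split; last exact: AX.
    by case: (chart_in cX (D0D a D0a)).
  exact: class_C_subset D0D (normal_C1 cX oS).
- by move=> _ [p SAp <-]; rewrite /= zy //; apply: nn; case: SAp.
- move=> _ v [p SAp <-].
  have [D [V [X [Z [D0 [V1 [Zy [u [cX [D0D AX] c [D0u Xu] _]]]]]]]]] := image_chart SAp.
  move: SAp; rewrite -Xu => SAp tv; have [h ->] := tangent_chart c D0u tv.
  rewrite /= zy // (solution_derive oS cX h sol (D0D u D0u)).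
  have := normal_tangent cX oS h (D0D u D0u).
  by rewrite dotZr dotDr !dotZr dot_crossl /= => ->; rewrite !mulr0 addr0 mulr0.
Qed.

(** With Y_i = e (c X_i + s n x X_i), minimality of the image is minimality of S
    together with the symmetry of its curvature tensor. *)
Lemma image_minimal : minimal_surface S' (nu \o z).
Proof.
split; first exact: image_oriented.
move=> _ [p SAp <-].
have [D [V [X [Z [D0 [V1 [Zy [u [cX [D0D AX] c [D0u Xu] _]]]]]]]]] := image_chart SAp.
have [_ Cn _ _] := image_oriented; have Du := D0D u D0u.
suff H : sdiv S' (nu \o z) (nu \o z) (y (X u)) = 0.
  by rewrite /mean_curvature -Xu H mul0r.
apply/(sdiv_eq0 c image_oriented Cn D0u).
have nE a : D0 a -> ((nu \o z) \o (y \o X)) a = (nu \o X) a.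
  move=> D0a; rewrite /= zy //; split; last exact: AX.
  by case: (chart_in cX (D0D a D0a)).
have dN v : 'D_v ((nu \o z) \o (y \o X)) u = 'D_v (nu \o X) u.
  by apply: near_eq_derive; exact: open_near_eq (chart_openD c) nE D0u.
have nEu : (nu \o z \o (y \o X)) u = (nu \o X) u := nE u D0u.
rewrite (dN e0) (dN e1) (solution_derive oS cX e0 sol Du).
rewrite (solution_derive oS cX e1 sol Du) nEu.
exact: (rotated_minimal (normal_tangent cX oS e0 Du)
  (normal_dnormal cX oS e0 Du) (minimal_eq cX oS (proj2 mS) Du) _ _ _
  (curvature_sym cX oS e0 e1 Du)).
Qed.

End Image.

Lemma solution_minimal_image S nu phi alpha y : minimal_surface S nu ->
  is_solution nu phi S alpha y -> minimal_image S y.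
Proof.
move=> mS sol; split=> [p Sp|A oA [cy [z [zy cz]]]].
  exact: (solution_embedding (proj1 mS) sol Sp).
by exists (nu \o z); exact: (image_minimal mS sol oA zy cz).
Qed.

End Deformations.

Unset Implicit Arguments.

Theorem mainTheorem1 (R : realType) (S : set 'cV[R]_3)
    (nu : 'cV[R]_3 -> 'cV[R]_3) (phi : 'cV[R]_3 -> R)
    (hS : minimal_surface S nu)
    (hK : forall p, S p -> gauss_curvature S nu p < 0)
    (hphi : surface_harmonic S nu phi) :
  let conjugate (T : set 'cV[R]_3) (alpha : 'cV[R]_3 -> R) :=
    surface_harmonic T nu alpha /\
    forall q, T q -> sgrad T nu alpha q = cross (nu q) (sgrad T nu phi q) in
  let solution (T : set 'cV[R]_3) (alpha : 'cV[R]_3 -> R)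
      (y : 'cV[R]_3 -> 'cV[R]_3) :=
    bending_neutral T nu y /\
    forall q, T q -> vsgrad T nu y q =
      expR (phi q) *: (rotmx (nu q) (alpha q) *m tanproj (nu q)) in
  (forall p, S p -> exists V alpha,
     open_nbhs p V /\ conjugate (S `&` V) alpha)
  /\
  (forall V alpha, open V -> conjugate (S `&` V) alpha ->
     [/\ forall p, (S `&` V) p -> exists W y,
           [/\ open_nbhs p W, W `<=` V, connected (S `&` W),
               embedding (S `&` W) y & solution (S `&` W) alpha y],
         connected (S `&` V) -> forall y1 y2,
           solution (S `&` V) alpha y1 -> solution (S `&` V) alpha y2 ->
           exists c, forall q, (S `&` V) q -> y2 q = y1 q + c
       & forall y, solution (S `&` V) alpha y -> minimal_image (S `&` V) y]).
Proof.
move=> conj sol; split=> [p Sp|V alpha oV calpha]; first exact: conjugate_exists.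
have mT := minimal_setI oV hS; have hT := harmonic_setI oV hphi.
split=> [p SVp|conT y1 y2|y].
- have [W [y [[oW Wp] conW embW solW]]] := deformation_exists mT hT calpha SVp.
  have Vp : V p by case: SVp.
  exists (V `&` W), y; rewrite setIA; split=> //.
  by split=> //; exact: openI.
- exact: (solution_unique (proj1 mT) conT).
- exact: solution_minimal_image.
Qed.
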